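(* Consider a $q$-state spin system with $n=|V|$ vertices. If it is $\eta$-spectrally independent and $b$-marginally bounded, then there exists a constant $C=O\left(1+\frac\eta b\right)$ such that for any $\ell\in\{1,\dots,n-1\}$ and for all $f:\Omega\to\mathbb R_+$: $$\frac n\ell\,\mathrm{Av}_{|U|=\ell}\,\mathrm{Ent}(\mu^Uf)\le C\,\mathrm{Ent}(f).$$ Moreover, for any $\theta\in(0,1]$, there exists $C=\left(\frac1\theta\right)^{O(\frac\eta b)}$ such that for $\ell=\lceil\theta n\rceil$ and all $f:\Omega\to\mathbb R_+$: $$\frac\ell n\,\mathrm{Ent}(f)\le C\,\mathrm{Av}_{|\Lambda|=\ell}\,\mu[\mathrm{Ent}_\Lambda(f)].$$ The implied constants in $O(\cdot)$ are absolute.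
   Context: Spin system. Let $q\ge2$, $[q]=\{1,\dots,q\}$, and let $G=(V\cup\partial V,E\cup\partial E)$ be a finite graph, where $\partial V$ is a (possibly empty) boundary set, $E$ is the set of edges inside $V$ and $\partial E$ the set of edges between $V$ and $\partial V$; $n=|V|$. Given nonnegative symmetric matrices $A_{xy}\in\mathbb R_+^{q\times q}$ for $\{x,y\}\in E\cup\partial E$, vectors $B_x\in\mathbb R_+^q$ for $x\in V$, and a boundary condition $\xi\in[q]^{\partial V}$, a configuration $\sigma\in[q]^V$ has weight $w(\sigma)=\prod_{\{x,y\}\in E}A_{xy}(\sigma_x,\sigma_y)\prod_{\{x,y\}\in\partial E,\,x\in V,\,y\in\partial V}A_{xy}(\sigma_x,\xi_y)\prod_{x\in V}B_x(\sigma_x)$. Let $\Omega=\{\sigma:w(\sigma)>0\}$ (assumed nonempty); the Gibbs distribution is $\mu(\sigma)\propto w(\sigma)$ on $\Omega$. Pinnings. For $U\subset V$, $\Omega_U$ is the set of $\tau\in[q]^U$ that extend to an element of $\Omega$; a pinning is an element $\tau\in\bigcup_U\Omega_U$. For $\tau\in\Omega_U$, $\mu^\tau=\mu(\cdot\mid\sigma_U=\tau)$ with support $\Omega^\tau$; $\Omega_x^\tau$ is the set of spins possible at $x$ under $\mu^\tau$; $\mathcal X^\tau=\{(x,a):x\in V\setminus U,a\in\Omega^\tau_x\}$. Standing assumption: $\mu$ is totally-connected, i.e. for every pinning $\tau$ the set $\Omega^\tau$ is connected under moves between configurations at Hamming distance 1. Influence matrix: $J^\tau\in\mathbb R^{\mathcal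 X^\tau\times\mathcal X^\tau}$ with $J^\tau(x,a;x,a')=0$ and $J^\tau(x,a;y,a')=\mu^\tau(\sigma_y=a'\mid\sigma_x=a)-\mu^\tau(\sigma_y=a')$ for $x\ne y$; its eigenvalues are real. The system is $\eta$-spectrally independent if the largest eigenvalue satisfies $\lambda_1(J^\tau)\le\eta$ for all pinnings $\tau$. It is $b$-marginally bounded ($b>0$) if $\mu^\tau(\sigma_x=a)\ge b$ for all pinnings $\tau$, all $x\in V$, all $a\in\Omega_x^\tau$. Notation. $\mathrm{Ent}(f)=\mu[f\log(f/\mu[f])]$. For $\Lambda\subset V$, $\mu_\Lambda$ is the conditional distribution of $\mu$ given the spins on $V\setminus\Lambda$, and $\mu[\mathrm{Ent}_\Lambda(f)]=\mu[f\log(f/\mu_\Lambda[f])]$. For $U\subset V$, $\mu^U=\mu_{V\setminus U}$ is the conditional distribution given the spins in $U$, so $\mu^Uf$ is the function $\sigma\mapsto\mu(f\mid\sigma_U)$. $\mathrm{Av}_{|U|=\ell}$ is the uniform average over all subsets $U\subset V$ with $\ell$ vertices. *)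

(* Defs.v *)
From mathcomp Require Import all_boot all_order all_algebra.
From mathcomp Require Import reals exp.
Set Implicit Arguments.
Unset Strict Implicit.
Unset Printing Implicit Defensive.
Import Order.TTheory GRing.Theory Num.Theory.
Local Open Scope ring_scope.

(* The graph is simple, with vertex set the disjoint union of V and the
   boundary bV; spin_edge is the edge set inside V and spin_bedge the set of
   edges between V and bV. The values of the interactions on non-edges are
   irrelevant. *)
Record spin_system (R : realType) (q : nat) (V bV : finType) := SpinSystem {
  spin_edge : rel V;
  spin_bedge : V -> bV -> bool;
  spin_A : V -> V -> 'M[R]_q;
  spin_bA : V -> bV -> 'M[R]_q;
  spin_B : V -> 'I_q -> R;
  spin_xi : {ffun bV -> 'I_q};
  spin_edge_sym : symmetric spin_edge;
  spin_edge_irr : irreflexive spin_edge;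
  spin_A_swap : forall x y, spin_edge x y -> spin_A x y = spin_A y x;
  spin_A_tr : forall x y, spin_edge x y -> (spin_A x y)^T = spin_A x y;
  spin_bA_tr : forall x y, spin_bedge x y -> (spin_bA x y)^T = spin_bA x y;
  spin_A_ge0 : forall x y, spin_edge x y -> forall a c, 0 <= spin_A x y a c;
  spin_bA_ge0 : forall x y, spin_bedge x y -> forall a c, 0 <= spin_bA x y a c;
  spin_B_ge0 : forall x a, 0 <= spin_B x a
}.

Section SpinSystem.
Variables (R : realType) (q : nat) (V bV : finType).
Variable S : spin_system R q V bV.

Definition config := {ffun V -> 'I_q}.

(* Comparing ranks lists each edge {x, y} inside V exactly once; by
   spin_A_swap and spin_A_tr the orientation does not matter. *)
Definition weight (s : config) : R :=
  (\prod_(p : V * V | spin_edge S p.1 p.2 &&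
                      (enum_rank p.1 < enum_rank p.2)%N)
      spin_A S p.1 p.2 (s p.1) (s p.2)) *
  (\prod_(p : V * bV | spin_bedge S p.1 p.2)
      spin_bA S p.1 p.2 (s p.1) (spin_xi S p.2)) *
  \prod_(x : V) spin_B S x (s x).

Definition Omega : {set config} := [set s | 0 < weight s].

Definition feasible : Prop := Omega != set0.

Definition mu (s : config) : R := weight s / \sum_t weight t.

Definition expect (m : config -> R) (f : config -> R) : R :=
  \sum_s m s * f s.

Definition prob (m : config -> R) (P : pred config) : R :=
  \sum_(s | P s) m s.

(* An element of [q]^U, with U ranging over the subsets of V, is encoded as a
   partial configuration whose domain is U. *)
Definition pconfig := {ffun V -> option 'I_q}.

Definition extends (tau : pconfig) (s : config) : bool :=
  [forall x, (tau x == None) || (tau x == Some (s x))].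

Definition restrict (U : {set V}) (s : config) : pconfig :=
  [ffun x => if x \in U then Some (s x) else None].

Definition Omega_pin (tau : pconfig) : {set config} :=
  [set s in Omega | extends tau s].

Definition pinning (tau : pconfig) : bool := Omega_pin tau != set0.

Definition mu_pin (tau : pconfig) (s : config) : R :=
  if extends tau s then mu s / prob mu (extends tau) else 0.

Definition spins_at (tau : pconfig) (x : V) : {set 'I_q} :=
  [set a | 0 < prob (mu_pin tau) [pred s : config | s x == a]].

Definition hamming (s t : config) : nat := #|[set x | s x != t x]|.

Definition totally_connected : Prop :=
  forall tau, pinning tau ->
  forall s t, s \in Omega_pin tau -> t \in Omega_pin tau ->
  connect [rel u v | [&& u \in Omega_pin tau, v \in Omega_pin tau
                       & hamming u v == 1%N]] s t.

Definition free_pairs (tau : pconfig) : {set V * 'I_q} :=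
  [set p | (tau p.1 == None) && (p.2 \in spins_at tau p.1)].

Definition influence_coef (tau : pconfig) (p r : V * 'I_q) : R :=
  if p.1 == r.1 then 0 else
  prob (mu_pin tau) [pred s : config | (s p.1 == p.2) && (s r.1 == r.2)]
    / prob (mu_pin tau) [pred s : config | s p.1 == p.2]
  - prob (mu_pin tau) [pred s : config | s r.1 == r.2].

Definition influence (tau : pconfig) : 'M[R]_#|free_pairs tau| :=
  \matrix_(i, j) influence_coef tau (enum_val i) (enum_val j).

(* The influence matrix is self-adjoint for the inner product weighted by the
   one-site marginals of mu_pin tau, so its eigenvalues are all in R, and a
   bound on the largest one is a bound on all of them. For a pinning of the
   whole of V the matrix is empty and there is no condition. *)
Definition spectrally_independent (eta : R) : Prop :=
  forall tau, pinning tau ->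
  forall lambda, eigenvalue (influence tau) lambda -> lambda <= eta.

Definition marginally_bounded (b : R) : Prop :=
  0 < b /\
  forall tau, pinning tau -> forall x a, a \in spins_at tau x ->
  b <= prob (mu_pin tau) [pred s : config | s x == a].

(* mu^U f, that is s |-> mu(f | s_U); it is only meaningful on Omega. *)
Definition mu_given (U : {set V}) (f : config -> R) (s : config) : R :=
  expect (mu_pin (restrict U s)) f.

(* Since ln 0 = 0, the convention 0 log 0 = 0 is built in. *)
Definition ent (f : config -> R) : R :=
  expect mu (fun s => f s * ln (f s / expect mu f)).

(* mu[Ent_Lambda(f)], where mu_Lambda conditions on the complement of Lambda. *)
Definition mean_ent_on (L : {set V}) (f : config -> R) : R :=
  expect mu (fun s => f s * ln (f s / mu_given (~: L) f s)).

End SpinSystem.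

Definition average_card (R : realType) (V : finType) (l : nat)
    (F : {set V} -> R) : R :=
  (\sum_(U : {set V} | #|U| == l) F U) / #|[set U : {set V} | #|U| == l]|%:R.

(* Main.v *)
Require Import Defs.
From mathcomp Require Import all_boot all_order all_algebra.
From mathcomp Require Import reals sequences exp.
From mathcomp Require Import complex ring lra.
Set Implicit Arguments.
Unset Strict Implicit.
Unset Printing Implicit Defensive.
Import Order.TTheory GRing.Theory Num.Theory.
Local Open Scope ring_scope.

(** For a fixed f, let rho_U = mu(f | sigma_U) and H(U) = mu[f ln rho_U]. Then
    Ent(mu^U f) = H(U) - H(empty) and mu[Ent_L(f)] = H(V) - H(V \ L), so both
    claims are about the averages of the monotone set function H over the sets
    of a given size.

    Fix a set W of pinned vertices that leaves m+1 vertices free, and write E_k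
    for the average of H(U) - H(W) over the U containing W with
    |U| = |W| + k; thus E_(m+1) = H(V) - H(W). For x, y outside W put
    F_x = rho_(W,x) / rho_W, a density of mean 1 depending on the spin at x
    only, and bounded by 1/b. The dual formula for the entropy,
    tested on the function min(F_x, M) min(F_y, M), bounds H(W,x,y) - H(W)
    from below by
      mu[f ln min(F_x, M)] + mu[f ln min(F_y, M)]
        - mu[rho_W Cov(min(F_x, M), min(F_y, M))],
    the covariance being conditional on the spins in W. Summed over x <> y,
    the covariances form a quadratic form in the influence matrix of the
    pinning, which eta-spectral independence bounds by
    eta times the sum over x of the means of (min(F_x, M) - 1)^2, since that
    matrix is self-adjoint (rayleigh_le, mu_given_cov_le). Finally the mean of
    (min(F, M) - 1)^2 is at most 4 M Ent(F). This is two_level_trunc. With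
    M = 1/b nothing is truncated, and
      E_2 >= (2 - c/m) E_1 with c = 4 eta / b   (two_level_spectral).
    Induction on the number of free vertices then gives E_l <= (1 + c) (l/n) E_n
    (layer1_le, layer_le), which is the first claim.

    For the second claim it suffices to show, for every W with m+1 >= 2 free
    vertices,
      E_(m+1) - E_1 >= (m / (m+1))^(1 + K eta/b) E_(m+1)   (layer1_le_powR),
    because these factors telescope (layer_gap_ge) and n/l <= 1/theta. If
    m >= 8 eta/b this follows from the bound on E_1 above. If m < 8 eta/b, put
    t = eta/(b m): it is enough that E_2 >= (1 + alpha) E_1 with alpha of order
    exp(-K t) or more. When 1/b >= 4 (16 t)^9 the truncation level
    M = 1/(16 b t) gives alpha = 1/2. Otherwise b is at least of the order
    of a negative power of t, and the bound alpha = b^7/72 is enough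
    (two_level_connected).
    That one holds for each pair x, y and uses total connectivity: the
    positive masses of pairs of spins are at least b^2, so a small value of
    H(W,x,y) - H(W,x) + H(W,x,y) - H(W,y) forces the square root of the pair
    density to vary little along every single-site move, hence to vary little
    at all, and then F_x and F_y are close to 1. *)

(** * Rayleigh quotients of symmetric matrices *)

Lemma row_diag_mx_mul (K : fieldType) (n : nat) (d : 'rV[K]_n) (P : 'M[K]_n) i :
  row i (diag_mx d *m P) = d 0 i *: row i P.
Proof. by apply/rowP => j; rewrite mul_diag_mx !mxE. Qed.

Local Notation toC := (map_mx (real_complex _)).

(** The Rayleigh quotients of a real symmetric matrix are bounded by its largest
    real eigenvalue: the complexified matrix is unitarily diagonalizable with
    real eigenvalues. *)
Lemma rayleigh_le (R : rcfType) (n : nat) (A : 'M[R]_n) (eta : R)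
    (v : 'rV[R]_n) :
  A^T = A -> (forall x, eigenvalue A x -> x <= eta) ->
  (v *m A *m v^T) 0 0 <= eta * (v *m v^T) 0 0.
Proof.
move=> Asym eigA.
pose B := (toC A : 'M[R[i]]_n).
have Breal : B \is a mxOver Num.real.
  by apply/mxOverP => i j; rewrite mxE; apply/complex_realP; exists (A i j).
have Bherm : B \is hermsymmx.
  apply: realsym_hermsym => //; apply/is_hermitianmxP.
  by rewrite expr0 scale1r map_mx_id // map_trmx Asym.
have /orthomx_spectralP := hermitian_normalmx Bherm.
have := hermitian_spectral_diag_real Bherm.
set P := spectralmx B; set d := spectral_diag B => dreal BE.
have Pu : P \is unitarymx := spectral_unitarymx B.
have Pun := unitarymx_unit Pu.
have PB : P *m B = diag_mx d *m P by rewrite {1}BE !mulmxA mulmxV // mul1mx.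
have dle i : d 0 i <= (eta%:C)%C.
  have /complex_realP[x dx] : d 0 i \is Num.real by move/mxOverP: dreal.
  rewrite dx lecR; apply: eigA; rewrite eigenvalue_root_char.
  rewrite -(fmorph_root (real_complex R)) map_char_poly -eigenvalue_root_char.
  apply/eigenvalueP; exists (row i P).
    by rewrite -row_mul -/B PB row_diag_mx_mul dx.
  apply/eqP => /(congr1 (fun z => z *m invmx P)).
  rewrite -row_mul mulmxV // mul0mx => /rowP/(_ i); rewrite !mxE eqxx.
  by move/eqP; rewrite oner_eq0.
have PE : invmx P = (map_mx Num.conj P^T) by apply: invmx_unitary.
pose w := toC v *m invmx P.
have vE : (map_mx Num.conj (toC v)^T) = toC v^T.
  apply/matrixP => i j; rewrite !mxE; apply/CrealP/complex_realP.
  by exists (v j i).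
have wE : map_mx Num.conj w^T = P *m toC v^T.
  rewrite /w trmx_mul map_mxM vE PE map_trmx trmxK -map_mx_comp.
  by rewrite (map_mx_id (@conjCK _)).
have E1 : ((v *m A *m v^T) 0 0)%:C%C =
    \sum_i d 0 i * (w 0 i * Num.conj (w 0 i)).
  have -> : ((v *m A *m v^T) 0 0)%:C%C = (toC (v *m A *m v^T)) 0 0.
    by rewrite [RHS]mxE.
  rewrite !map_mxM -/B BE !mulmxA -/w -mulmxA -wE mxE.
  by apply: eq_bigr => i _; rewrite mul_mx_diag !mxE; ring.
have E2 : ((v *m v^T) 0 0)%:C%C = \sum_i (w 0 i * Num.conj (w 0 i)).
  have -> : ((v *m v^T) 0 0)%:C%C = (toC (v *m v^T)) 0 0 by rewrite [RHS]mxE.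
  rewrite !map_mxM -[X in X *m _](mulmxKV Pun) -/w -mulmxA -wE mxE.
  by apply: eq_bigr => i _; rewrite !mxE.
rewrite -lecR rmorphM /= E1 E2 mulr_sumr; apply: ler_sum => i _.
by rewrite ler_wpM2r ?mul_conjC_ge0.
Qed.

(** * Scalar inequalities *)

Section RealInequalities.
Context {R : realType}.
Implicit Types f g x M B s m t b : R.

Lemma ln_leB1 x : 0 < x -> ln x <= x - 1.
Proof.
move=> x0; have := @le_ln1Dx R (x - 1).
by rewrite addrCA subrr addr0; apply; lra.
Qed.

(** Lower bound on the relative entropy density by the Hellinger distance. *)
Lemma mul_ln_div_ge_sqrt f g : 0 <= f -> 0 <= g -> (g = 0 -> f = 0) ->
  f - g + (Num.sqrt f - Num.sqrt g) ^+ 2 <= f * ln (f / g).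
Proof.
move=> f0 g0 gf; have [gz|gnz] := eqVneq g 0.
  by rewrite (gf gz) gz mul0r !subr0 add0r subrr expr0n.
have gp : 0 < g by rewrite lt_neqAle eq_sym gnz.
have [->|fnz] := eqVneq f 0.
  by rewrite mul0r sqrtr0 !sub0r sqrrN sqr_sqrtr // addNr.
have fp : 0 < f by rewrite lt_neqAle eq_sym fnz.
set u := Num.sqrt f; set v := Num.sqrt g.
have up : 0 < u by rewrite sqrtr_gt0.
have vp : 0 < v by rewrite sqrtr_gt0.
have uE : f = u ^+ 2 by rewrite sqr_sqrtr.
have vE : g = v ^+ 2 by rewrite sqr_sqrtr.
have -> : ln (f / g) = - (ln (v / u) *+ 2).
  rewrite uE vE -expr_div_n lnXn ?divr_gt0 // -mulNrn.
  by rewrite -lnV ?posrE ?divr_gt0 // invf_div.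
have h := ln_leB1 (divr_gt0 vp up).
have : f * ln (v / u) <= f * (v / u - 1) by rewrite ler_pM2l.
have -> : f * (v / u - 1) = u * v - u ^+ 2.
  by rewrite uE; field; rewrite gt_eqF.
by rewrite mulrN mulrnAr uE vE mulr2n; nra.
Qed.

Lemma mul_ln_div_ge f g : 0 <= f -> 0 <= g -> (g = 0 -> f = 0) ->
  f - g <= f * ln (f / g).
Proof.
move=> f0 g0 gf; apply: le_trans (mul_ln_div_ge_sqrt f0 g0 gf).
by rewrite lerDl sqr_ge0.
Qed.

(** In the names below psi is the function f ln f - f + 1, whose mean is the
    entropy of f when f has mean 1. *)
Lemma psi_ge_sqrt f : 0 <= f ->
  (Num.sqrt f - 1) ^+ 2 <= f * ln f - f + 1.
Proof.
move=> f0; have := mul_ln_div_ge_sqrt f0 (@ler01 R).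
have h : (1 : R) = 0 -> f = 0 by move=> /eqP; rewrite oner_eq0.
by move=> /(_ h); rewrite sqrtr1 divr1; lra.
Qed.

Lemma psi_ge0 f : 0 <= f -> 0 <= f * ln f - f + 1.
Proof. by move=> f0; apply: le_trans (sqr_ge0 _) (psi_ge_sqrt f0). Qed.

Lemma psi_le_sqr f : 0 <= f -> f * ln f - f + 1 <= (f - 1) ^+ 2.
Proof.
rewrite le_eqVlt => /predU1P[<-|fp]; first by rewrite
  mul0r !sub0r sqrrN expr1n oppr0 add0r.
have : f * ln f <= f * (f - 1) by rewrite ler_pM2l // ln_leB1.
by lra.
Qed.

Lemma ler_dist2 (u v w d : R) :
  `|u - w| <= d -> `|v - w| <= d -> `|u - v| <= 2 * d.
Proof.
rewrite !ler_norml => /andP[h1 h2] /andP[h3 h4].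
by apply/andP; split; lra.
Qed.

Lemma sqr_sub1_le f M : 0 <= f -> f <= M -> 1 <= M ->
  (f - 1) ^+ 2 <= 4 * M * (Num.sqrt f - 1) ^+ 2.
Proof.
move=> f0 fM M1; set u := Num.sqrt f.
have u0 : 0 <= u by exact: sqrtr_ge0.
have uE : f = u ^+ 2 by rewrite sqr_sqrtr.
have -> : (f - 1) ^+ 2 = (u + 1) ^+ 2 * (u - 1) ^+ 2 by rewrite uE; ring.
rewrite ler_wpM2r ?sqr_ge0 //.
have := sqr_ge0 (u - 1); rewrite uE in fM; nra.
Qed.

Lemma sqr_min_sub1_le_psi f M : 0 <= f -> 1 <= M ->
  (Num.min f M - 1) ^+ 2 <= 4 * M * (f * ln f - f + 1).
Proof.
move=> f0 M1; have M0 : 0 <= M by lra.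
apply: (@le_trans _ _ (4 * M * (Num.sqrt f - 1) ^+ 2)); last first.
  by rewrite ler_wpM2l ?psi_ge_sqrt //; lra.
have [fM|Mf] := leP f M; first exact: sqr_sub1_le.
apply: le_trans (sqr_sub1_le M0 (lexx _) M1) _.
rewrite ler_wpM2l //; first by lra.
have a1 : 1 <= Num.sqrt M by rewrite -sqrtr1 ler_sqrt.
have a2 : Num.sqrt M <= Num.sqrt f by rewrite ler_sqrt; lra.
nra.
Qed.

(** Truncating f at a level M with B/M much smaller than M costs at most an
    eighth of f ln f - f + 1. *)
Lemma mul_ln_min_ge f M B : 0 <= f -> f <= B -> 1 <= M ->
  1 + 8 * ln (B / M) <= ln M ->
  f * ln f - (f * ln f - f + 1) / 8 <= f * ln (Num.min f M).
Proof.
move=> f0 fB M1 H; have ps := psi_ge0 f0.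
have [fM|Mf] := leP f M; first by lra.
have fp : 0 < f by lra.
have Mp : 0 < M by lra.
have h1 : ln f <= ln B by rewrite ler_ln ?posrE //; lra.
have h2 : ln M <= ln f by rewrite ler_ln ?posrE //; lra.
rewrite ln_div ?posrE in H; [|lra|lra].
have : f * (ln f - 1) >= f * (8 * (ln f - ln M)) by rewrite ler_wpM2l //; lra.
by lra.
Qed.

(** In the next lemmas s stands for eta/b and m+1 for the number of free
    vertices. *)
Lemma powR_ratio_le K s m : 0 <= K -> 0 <= s -> 1 <= m ->
  (m / (m + 1)) `^ (1 + K * s) <= m / (m + 1) * expR (- (K * s / (2 * m))).
Proof.
move=> K0 s0 m1; have p : 0 < m / (m + 1) by rewrite divr_gt0 //; lra.
have -> : (m / (m + 1)) `^ (1 + K * s) =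
          (m / (m + 1)) `^ 1 * (m / (m + 1)) `^ (K * s).
  by apply: powRD; rewrite (gt_eqF p) implybT.
rewrite powRr1 ?(ltW p) // ler_pM2l //.
rewrite /powR gt_eqF // ler_expR -mulrN ler_wpM2l ?mulr_ge0 //.
apply: le_trans (ln_leB1 p) _.
have -> : m / (m + 1) - 1 = - (m + 1)^-1 by field; lra.
by rewrite lerN2 lef_pV2 ?posrE; lra.
Qed.

Lemma powR_ratio_large s m K : 16 <= K -> 0 <= s -> 1 <= m -> 8 * s <= m ->
  (m / (m + 1)) `^ (1 + K * s) <= (m - 4 * s) / (m + 1).
Proof.
move=> K16 s0 m1 sm; apply: le_trans (powR_ratio_le _ s0 m1) _; first lra.
have -> : (m - 4 * s) / (m + 1) = m / (m + 1) * (1 - 4 * s / m).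
  by field; apply/andP; split; lra.
rewrite ler_pM2l; last by rewrite divr_gt0 //; lra.
set x := 4 * s / m.
have x0 : 0 <= x by rewrite divr_ge0 //; lra.
have x2 : 2 * x <= 1.
  by rewrite /x mulrA ler_pdivrMr; lra.
have xx : 2 * x <= K * s / (2 * m).
  have -> : K * s / (2 * m) = K / 8 * x by rewrite /x; field; lra.
  nra.
rewrite expRN.
apply: (@le_trans _ _ (1 + 2 * x)^-1); last first.
  rewrite -[_^-1]mul1r ler_pdivrMr; last by lra.
  nra.
rewrite lef_pV2 ?posrE ?expR_gt0 //; last by lra.
by have := expR_ge1Dx (K * s / (2 * m)); lra.
Qed.

Lemma powR_ratio_small s m K : 48 <= K -> 0 <= s -> 1 <= m -> m < 8 * s ->
  (m / (m + 1)) `^ (1 + K * s) <= 1 / 4.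
Proof.
move=> K48 s0 m1 sm; apply: le_trans (powR_ratio_le _ s0 m1) _; first lra.
have h : 3 <= K * s / (2 * m).
  by rewrite ler_pdivlMr; nra.
have := expR_ge1Dx (K * s / (2 * m)) => h2.
have : expR (- (K * s / (2 * m))) <= 1/4.
  rewrite expRN -[_^-1]mul1r ler_pdivrMr ?expR_gt0 //; lra.
have : m / (m + 1) <= 1 by rewrite ler_pdivrMr; lra.
have : 0 <= m / (m + 1) by rewrite divr_ge0; lra.
have := expR_gt0 (- (K * s / (2 * m))); nra.
Qed.

Lemma powR_ratio_crude s m K b : 4096 <= K -> 0 <= s -> 1 <= m -> m < 8 * s ->
  0 < b -> b^-1 <= 4 * (16 * (s / m)) ^+ 9 ->
  (m / (m + 1)) `^ (1 + K * s) <= b ^+ 7 / 256.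
Proof.
move=> K4 s0 m1 sm b0 hb; apply: le_trans (powR_ratio_le _ s0 m1) _; first lra.
set t := 16 * (s / m).
have t2 : 2 <= t by rewrite /t mulrA ler_pdivlMr; lra.
have E : 85 * t <= K * s / (2 * m).
  have -> : K * s / (2 * m) = K / 32 * t by rewrite /t; field; lra.
  nra.
have h : (b ^+ 7 / 256)^-1 <= expR (K * s / (2 * m)).
  apply: (@le_trans _ _ (t ^+ 85)); last first.
    apply: (@le_trans _ _ (expR (85 * t))); last by rewrite ler_expR.
    rewrite expRM_natl lerXn2r ?nnegrE ?expR_ge0 //; first lra.
    by have := expR_ge1Dx t; lra.
  rewrite invf_div.
  have -> : 256 / b ^+ 7 = 256 * (b^-1) ^+ 7 by rewrite exprVn.
  have t0 : 0 <= t by lra.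
  have b1 : 0 <= b^-1 by rewrite invr_ge0 ltW.
  have t4 : 4 <= t ^+ 2 by nra.
  have hb' : b^-1 <= t ^+ 11.
    by apply: le_trans hb _; rewrite (exprD t 2 9) ler_wpM2r // exprn_ge0.
  have h7 : (b^-1) ^+ 7 <= t ^+ 77.
    by rewrite (exprM t 11 7) lerXn2r // nnegrE exprn_ge0.
  have h8 : 256 <= t ^+ 8.
    have -> : 256 = 2 ^+ 8 :> R by ring.
    by rewrite lerXn2r ?nnegrE //; lra.
  by rewrite [leRHS](exprD t 8 77) ler_pM // exprn_ge0.
have : expR (- (K * s / (2 * m))) <= b ^+ 7 / 256.
  rewrite expRN -[leRHS]invrK lef_pV2 ?posrE ?expR_gt0 // invr_gt0.
  by rewrite divr_gt0 // exprn_gt0.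
apply: le_trans; rewrite -[leRHS]mul1r ler_wpM2r ?expR_ge0 //.
by rewrite ler_pdivrMr; lra.
Qed.

(** The level M = 1/(16 b t), with t = s/m, is admissible in mul_ln_min_ge for
    B = 1/b as soon as 1/b >= 4 (16 t)^9. *)
Lemma trunc_level s m b : 0 < b -> 1 <= m -> m < 8 * s ->
  4 * (16 * (s / m)) ^+ 9 <= b^-1 ->
  let M := (16 * (b * (s / m)))^-1 in
  1 <= M /\ 1 + 8 * ln (b^-1 / M) <= ln M.
Proof.
move=> b0 m1 sm hb M; set t := 16 * (s / m) in hb.
have t2 : 2 <= t by rewrite /t mulrA ler_pdivlMr; lra.
have tp : 0 < t by lra.
have ME : M = b^-1 / t by rewrite /M /t; field; apply/and3P; split; lra.
have M8 : 4 * t ^+ 8 <= M.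
  rewrite ME ler_pdivlMr //; apply: le_trans hb.
  by rewrite -mulrA -exprSr.
have h8 : 256 <= t ^+ 8.
  have -> : 256 = 2 ^+ 8 :> R by ring.
  by rewrite lerXn2r ?nnegrE //; lra.
have Mp : 0 < M by lra.
split; first lra.
have -> : b^-1 / M = t by rewrite ME; field; apply/andP; split; lra.
have : ln (4 * t ^+ 8) <= ln M by rewrite ler_ln ?posrE //; lra.
rewrite lnM ?posrE ?lnXn //; last by lra.
have : 1 <= ln (4 : R).
  rewrite -ler_expR lnK ?posrE //.
  have e : expR (1:R) = expR (2^-1) ^+ 2 by rewrite -expRM_natl; congr expR; field.
  have h : expR (- 2^-1 : R) >= 2^-1 by apply: le_trans (expR_ge1Dx _); lra.
  have : expR (2^-1 : R) <= 2.
    by rewrite -[expR _]invrK -expRN -[leRHS]invrK lef_pV2 // posrE ?expR_gt0 ?invr_gt0.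
  rewrite e; have := expR_gt0 (2^-1 : R); nra.
by rewrite -mulr_natl; lra.
Qed.

End RealInequalities.

(** * Averages of a set function over layers *)

Section LayerAverages.
Variables (R : realType) (V : finType) (H : {set V} -> R).
Implicit Types (W U : {set V}) (x y : V) (k l N : nat).

(** layer_avg k W is the average of H over the supersets of W with #|W| + k
    elements, computed by adding k uniformly random new elements one at a time
    (see layer_avg_sum). When fewer than k elements are left its value is 0. *)
Fixpoint layer_avg k W : R :=
  if k is k'.+1 then (\sum_(x in ~: W) layer_avg k' (x |: W)) / #|~: W|%:R
  else H W.

Local Notation T := layer_avg.

Lemma card_setCU1 x W N : #|~: W| = N.+1 -> x \in ~: W -> #|~: (x |: W)| = N.
Proof.
move=> cW; rewrite inE => xW.
have := cardsC W; have := cardsC (x |: W); rewrite cardsU1 xW cW.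
by rewrite add1n addSn addnS => <- [] /addnI.
Qed.

Lemma sum_pair_fst (g : V -> R) W N : #|~: W| = N.+1 ->
  \sum_(x in ~: W) \sum_(y in ~: (x |: W)) g x = N%:R * \sum_(x in ~: W) g x.
Proof.
move=> cW; rewrite mulr_sumr; apply: eq_bigr => x xW.
by rewrite sumr_const (card_setCU1 cW xW) mulr_natl.
Qed.

Lemma sum_pair_snd (g : V -> R) W N : #|~: W| = N.+1 ->
  \sum_(x in ~: W) \sum_(y in ~: (x |: W)) g y = N%:R * \sum_(x in ~: W) g x.
Proof.
move=> cW; rewrite -(sum_pair_fst g cW) (exchange_big_dep (mem (~: W))) /=; last first.
  by move=> x y _; rewrite !inE negb_or => /andP[].
apply: eq_bigr => x xW; apply: eq_bigl => y; rewrite !inE negb_or.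
rewrite inE in xW; rewrite xW andbT eq_sym andbC.
by case: (y =P x) => [->|//]; rewrite (negbTE xW).
Qed.

Lemma layer_avgS k W N : #|~: W| = N.+1 ->
  N.+1%:R * T k.+1 W = \sum_(x in ~: W) T k (x |: W).
Proof. by move=> /= ->; rewrite mulrC divfK // pnatr_eq0. Qed.

Lemma layer_avg1_gap W N : #|~: W| = N.+1 ->
  \sum_(x in ~: W) (H (x |: W) - H W) = N.+1%:R * (T 1 W - H W).
Proof.
by move=> cW; rewrite sumrB sumr_const cW mulrBr (layer_avgS 0 cW) mulr_natl.
Qed.

Lemma layer_avg2_gap W N : #|~: W| = N.+2 ->
  \sum_(x in ~: W) \sum_(y in ~: (x |: W)) (H (y |: (x |: W)) - H W) =
  N.+2%:R * (N.+1%:R * (T 2 W - H W)).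
Proof.
move=> cW; rewrite mulrCA mulrBr (layer_avgS 1 cW) mulrBr mulr_sumr.
rewrite [_ * H W]mulr_natl -cW -sumr_const mulr_sumr -sumrB.
apply: eq_bigr => x xW.
have cx := card_setCU1 cW xW.
by rewrite sumrB sumr_const cx (layer_avgS 0 cx) mulr_natl.
Qed.

Lemma layer_avg_sum k W : (k <= #|~: W|)%N ->
  T k W * 'C(#|~: W|, k)%:R =
  \sum_(U : {set V} | (W \subset U) && (#|U| == #|W| + k)%N) H U.
Proof.
elim: k W => [|k IH] W kN.
  rewrite bin0 mulr1 (big_pred1 W) // => U /=; rewrite addn0.
  apply/andP/eqP => [[WU /eqP e]|->]; last by rewrite subxx eqxx.
  by apply/eqP; rewrite eq_sym eqEcard WU e leqnn.
case cN: #|~: W| kN => [//|N] kN.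
have k0 : k.+1%:R != 0 :> R by rewrite pnatr_eq0.
apply: (mulfI k0).
have -> : k.+1%:R * (T k.+1 W * 'C(N.+1, k.+1)%:R) =
    N.+1%:R * T k.+1 W * 'C(N, k)%:R.
  rewrite [RHS]mulrAC -natrM (mul_bin_diag N.+1 k) natrM; ring.
rewrite layer_avgS // mulr_suml.
transitivity (\sum_(x in ~: W) \sum_(U : {set V} |
     [&& W \subset U, #|U| == (#|W| + k.+1)%N & x \in U]) H U).
  apply: eq_bigr => x xW; have cx := card_setCU1 cN xW.
  rewrite -[N in 'C(N, _)]cx IH ?cx //; apply: eq_bigl => U.
  rewrite subUset sub1set cardsU1; rewrite inE in xW; rewrite xW add1n addSnnS.
  by case: (x \in U); rewrite ?andbT ?andbF.
rewrite (exchange_big_dep (fun U : {set V} =>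
   (W \subset U) && (#|U| == (#|W| + k.+1)%N))) /=; last first.
  by move=> x U _ /and3P[-> ->].
rewrite mulr_sumr; apply: eq_bigr => U /andP[WU cU].
rewrite (eq_bigl (fun x => x \in U :\: W)); last first.
  by move=> x; rewrite !inE WU cU.
by rewrite sumr_const cardsDS // (eqP cU) addKn mulr_natl.
Qed.

Lemma average_card_layer l : (l <= #|V|)%N -> average_card l H = T l set0.
Proof.
move=> lV; have := @layer_avg_sum l set0; rewrite setC0 cardsT => /(_ lV) E.
rewrite /average_card card_draws.
rewrite (eq_bigl (fun U : {set V} => (set0 \subset U) && (#|U| == #|@set0 V| + l)%N)).
  by rewrite -E mulfK // pnatr_eq0 -lt0n bin_gt0.
by move=> U; rewrite sub0set cards0.
Qed.

Hypothesis Hmono : forall W x, H W <= H (x |: W).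

Lemma le_setT W : H W <= H setT.
Proof.
have [N] := ubnP #|~: W|; elim: N W => // N IH W; rewrite ltnS => cW.
have [/(congr1 (@setC V))|/set0Pn[x xW]] := eqVneq (~: W) set0.
  by rewrite setCK setC0 => ->.
apply: le_trans (Hmono W x) (IH _ _); apply: leq_trans cW.
case cN: #|~: W| => [|M]; last by rewrite (card_setCU1 cN xW).
by move: xW; rewrite (cards0_eq cN) inE.
Qed.


Lemma layer_avg_full W : T #|~: W| W = H setT.
Proof.
case cN : #|~: W| => [|N] /=.
  by move/(congr1 (@setC V)): (cards0_eq cN); rewrite setCK setC0 => ->.
elim: N W cN => [|N IH] W cN.
  rewrite cN divr1 (eq_bigr (fun=> H setT)) ?sumr_const ?cN // => x xW /=.
  move: (card_setCU1 cN xW) => /cards0_eq/(congr1 (@setC V)).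
  by rewrite setCK setC0 => ->.
rewrite (eq_bigr (fun=> H setT)).
  by rewrite sumr_const cN -[H setT *+ _]mulr_natr mulfK // pnatr_eq0.
by move=> x xW; apply: (IH (x |: W)); exact: card_setCU1 cN xW.
Qed.

Lemma layer_avg_le_setT k W : (k <= #|~: W|)%N -> T k W <= H setT.
Proof.
elim: k W => [|k IH] W; first by move=> _; exact: le_setT.
case cN: #|~: W| => [//|N]; rewrite ltnS => kN.
rewrite -(@ler_pM2l _ N.+1%:R) ?ltr0n // (layer_avgS k cN).
rewrite -cN mulr_natl -sumr_const; apply: ler_sum => x xW.
by apply: IH; rewrite (card_setCU1 cN xW).
Qed.

Lemma le_layer_avg1 W N : #|~: W| = N.+1 -> H W <= T 1 W.
Proof.
move=> cN; rewrite -(@ler_pM2l _ N.+1%:R) ?ltr0n // (layer_avgS 0 cN).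
by rewrite -cN mulr_natl -sumr_const; apply: ler_sum => x xW /=.
Qed.

(** The next two lemmas average over x outside W an inequality that holds from
    x |: W upwards. *)
Lemma layer_avg_step_le k a W N : #|~: W| = N.+1 ->
  (forall x, x \in ~: W -> T k (x |: W) - H (x |: W) <= a * (H setT - H (x |: W))) ->
  T k.+1 W - T 1 W <= a * (H setT - T 1 W).
Proof.
move=> cN h; have N0 : 0 < N.+1%:R :> R by rewrite ltr0n.
rewrite -(ler_pM2l N0) mulrCA !mulrBr !(layer_avgS _ cN) /=.
have -> : N.+1%:R * H setT = \sum_(x in ~: W) H setT.
  by rewrite sumr_const cN mulr_natl.
by rewrite -mulrBr -!sumrB mulr_sumr; apply: ler_sum => x xW; exact: h.
Qed.

Lemma layer_avg_step_ge k a W N : #|~: W| = N.+1 ->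
  (forall x, x \in ~: W -> a * (H setT - H (x |: W)) <= H setT - T k (x |: W)) ->
  a * (H setT - T 1 W) <= H setT - T k.+1 W.
Proof.
move=> cN h; have N0 : 0 < N.+1%:R :> R by rewrite ltr0n.
rewrite -(ler_pM2l N0) mulrCA !mulrBr !(layer_avgS _ cN) /=.
have -> : N.+1%:R * H setT = \sum_(x in ~: W) H setT.
  by rewrite sumr_const cN mulr_natl.
by rewrite -mulrBr -!sumrB mulr_sumr; apply: ler_sum => x xW; exact: h.
Qed.

Section LocalToGlobal.
Variable c : R.
Hypothesis c0 : 0 <= c.
Hypothesis loc : forall W N, #|~: W| = N.+2 ->
  (2 - c / N.+1%:R) * (T 1 W - H W) <= T 2 W - H W.

(** The first layer carries at most its share of the total increase, up to the
    factor 1 + c. The two-level hypothesis bounds layer 1 by layer 2, and the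
    induction hypothesis, used from each x |: W, bounds layer 2 by the total. *)
Lemma layer1_le W N : #|~: W| = N.+1 ->
  T 1 W - H W <= (1 + c) / N.+1%:R * (H setT - H W).
Proof.
elim: N W => [|N IH] W cN.
  have -> : T 1 W = H setT by rewrite -(layer_avg_full W) cN.
  by rewrite divr1 ler_peMl ?subr_ge0 ?le_setT // lerDl.
have N1 : 0 < N.+1%:R :> R by rewrite ltr0n.
have h1 := layer_avg_step_le cN (fun x xW => IH _ (card_setCU1 cN xW)).
have h2 := loc cN.
have En : N.+2%:R = N.+1%:R + 1 :> R by rewrite -natr1.
rewrite En; move: N.+1%:R (T 2 W) (T 1 W) (H W) (H setT) N1 h1 h2.
move=> n t2 t1 h ht n0 h1 h2.
rewrite mulrAC ler_pdivlMr; last by lra.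
have k : (n - c) * (t1 - h) <= (1 + c) * (ht - t1).
  have -> : (n - c) * (t1 - h) = n * ((2 - c / n) * (t1 - h) - (t1 - h)).
    by field; rewrite gt_eqF.
  have -> : (1 + c) * (ht - t1) = n * ((1 + c) / n * (ht - t1)).
    by field; rewrite gt_eqF.
  by rewrite ler_pM2l //; apply: le_trans h1; move: h2; lra.
have cp := c0; lra.
Qed.

Lemma layer_le W N l : #|~: W| = N.+1 -> (1 <= l <= N.+1)%N ->
  T l W - H W <= (1 + c) * (l%:R / N.+1%:R) * (H setT - H W).
Proof.
elim: N W l => [|N IH] W [|l] cN // lN.
  have -> : l = 0%N by case: l lN.
  by have := layer1_le cN; rewrite mulrA mulr1.
have h1 := layer1_le cN.
have [l0|lp] := posnP l; first by rewrite l0 mulrA mulr1.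
have lN' : (1 <= l <= N.+1)%N by rewrite lp.
have h2 := layer_avg_step_le cN (fun x xW => IH _ l (card_setCU1 cN xW) lN').
have N1 : 0 < N.+1%:R :> R by rewrite ltr0n.
have D0 : 0 <= H setT - H W by rewrite subr_ge0 le_setT.
have E0 : 0 <= T 1 W - H W by rewrite subr_ge0 (le_layer_avg1 cN).
have lR : l%:R <= N.+1%:R :> R by rewrite ler_nat; case/andP: lN'.
have l1 : 1 <= l%:R :> R by rewrite ler1n.
have En : N.+2%:R = N.+1%:R + 1 :> R by rewrite -natr1.
have El : l.+1%:R = l%:R + 1 :> R by rewrite -natr1.
rewrite En El in h1 *.
have -> : T l.+1 W - H W = (T l.+1 W - T 1 W) + (T 1 W - H W).
  by rewrite addrA subrK.
have Dh : H setT - T 1 W = (H setT - H W) - (T 1 W - H W).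
  by rewrite opprB addrA subrK.
rewrite Dh in h2; apply: (le_trans (lerD h2 (lexx _))).
move: N.+1%:R l%:R (T 1 W - H W) (H setT - H W) N1 lR l1 h1 D0 E0.
move=> n k E D n0 lR l1 h1 D0 E0 {h2 Dh En El cN lN lN' lp IH W}; have cp := c0.
have kn : 0 <= k / n by rewrite divr_ge0 //; lra.
have [h|h] := leP ((1 + c) * (k / n)) 1.
- have : (1 - (1 + c) * (k / n)) * E <=
         (1 - (1 + c) * (k / n)) * ((1 + c) / (n + 1) * D).
    by rewrite ler_wpM2l //; lra.
  suff : (1 - (1 + c) * (k / n)) * ((1 + c) / (n + 1)) + (1 + c) * (k / n) <=
       (1 + c) * ((k + 1) / (n + 1)).
    move=> /(ler_wpM2r D0); lra.
  rewrite -subr_ge0.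
  have -> : (1 + c) * ((k + 1) / (n + 1)) -
      ((1 - (1 + c) * (k / n)) * ((1 + c) / (n + 1)) + (1 + c) * (k / n)) =
      (1 + c) * c * k / (n * (n + 1)) by field; apply/andP; split; lra.
  by apply: divr_ge0; rewrite !mulr_ge0 //; lra.
- have : (1 + c) * (k / n) * D <= (1 + c) * ((k + 1) / (n + 1)) * D.
    rewrite ler_wpM2r // ler_wpM2l; [|lra|].
      lra.
    by rewrite ler_pdivrMr // mulrAC ler_pdivlMr; lra.
  nra.
Qed.
End LocalToGlobal.

(** If removing the first layer keeps a fraction (m/(m+1))^p of the increase
    whenever m+1 elements are left, these fractions telescope. *)
Lemma layer_gap_ge (p : R) : 0 <= p ->
  (forall W N, #|~: W| = N.+2 ->
     T 1 W - H W <= (1 - (N.+1%:R / (N.+1%:R + 1)) `^ p) * (H setT - H W)) ->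
  forall W N l, #|~: W| = N -> (1 <= l <= N)%N ->
  (l%:R / N%:R) `^ p * (H setT - H W) <= H setT - T (N - l)%N W.
Proof.
move=> p0 loc W N l; elim: N W => [|N IH] W cN /andP[l1 lN].
  by have := leq_trans l1 lN.
have [->|ne] := eqVneq l N.+1.
  by rewrite subnn divff ?pnatr_eq0 // powR1 mul1r.
have {ne lN}lN : (l <= N)%N by rewrite -ltnS ltn_neqAle ne.
case: N cN IH lN => [|N] cN IH lN; first by have := leq_trans l1 lN.
rewrite subSn //.
have h1 : (l%:R / N.+1%:R) `^ p * (H setT - T 1 W) <= H setT - T (N.+1 - l).+1 W.
  apply: (layer_avg_step_ge cN) => x xW; apply: IH (card_setCU1 cN xW) _.
  by rewrite l1.
apply: le_trans h1.
have N0 : 0 < N.+1%:R :> R by rewrite ltr0n.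
have -> : l%:R / N.+2%:R = (l%:R / N.+1%:R) * (N.+1%:R / (N.+1%:R + 1)) :> R.
  by rewrite natr1 mulrA divfK // gt_eqF.
rewrite powRM ?divr_ge0 // ?addr_ge0 //.
rewrite -mulrA ler_wpM2l ?powR_ge0 //.
by have := loc W N cN; lra.
Qed.

End LayerAverages.

(** * Conditioning on the spins of a vertex set *)

Section Conditioning.
Variables (R : realType) (q : nat) (V bV : finType) (S : spin_system R q V bV).
Hypothesis feas : feasible S.
Local Notation config := (config q V).
Implicit Types (s t r : config) (U W : {set V}) (g h : config -> R) (x y : V).

(** The configurations s and t have the same spins on U. *)
Definition agree U s t := [forall x in U, s x == t x].

Lemma agreeP U s t : reflect {in U, s =1 t} (agree U s t).
Proof. by apply: (iffP forall_inP) => h x /h; [move/eqP | move->]. Qed.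

Lemma agree_refl U s : agree U s s. Proof. exact/agreeP. Qed.

Lemma agree_sym U s t : agree U s t = agree U t s.
Proof. by apply/agreeP/agreeP => h x /h. Qed.

Lemma agree_trans U s t r : agree U s t -> agree U t r -> agree U s r.
Proof. by move=> /agreeP h1 /agreeP h2; apply/agreeP => x xU; rewrite h1 ?h2. Qed.

Lemma agree_eql U s t r : agree U s t -> agree U s r = agree U t r.
Proof.
move=> st; apply/idP/idP; last exact: agree_trans.
by apply: agree_trans; rewrite agree_sym.
Qed.

Lemma agreeS U W s t : W \subset U -> agree U s t -> agree W s t.
Proof. by move=> /subsetP WU /agreeP h; apply/agreeP => x /WU /h. Qed.

Lemma agreeU1 W s t x : agree (x |: W) s t = agree W s t && (s x == t x).
Proof.
apply/agreeP/andP => [h|[/agreeP h /eqP e] y].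
  by split; [apply/agreeP => y yW; apply: h; rewrite !inE yW orbT
            | rewrite h // !inE eqxx].
by rewrite !inE => /predU1P[->|/h].
Qed.

Lemma extends_restrict U s t : extends (Defs.restrict U s) t = agree U s t.
Proof.
apply/forallP/forall_inP => h x; have := h x; rewrite /Defs.restrict ffunE.
  by move=> + xU; rewrite xU /= => /eqP [->].
by case: (x \in U) => // /(_ isT) /eqP ->; rewrite eqxx.
Qed.

Lemma restrict_agree U s t : agree U s t -> Defs.restrict U s = Defs.restrict U t.
Proof.
by move/agreeP => h; apply/ffunP => x; rewrite !ffunE; case: ifP => // /h ->.
Qed.

Lemma weight_ge0 s : 0 <= weight S s.
Proof.
rewrite /weight !mulr_ge0 ?prodr_ge0 //.
- by move=> p /andP[e _]; exact: spin_A_ge0.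
- by move=> p e; exact: spin_bA_ge0.
- by move=> x _; exact: spin_B_ge0.
Qed.

Lemma sum_weight_gt0 : 0 < \sum_s weight S s.
Proof.
have /set0Pn[s] := feas; rewrite inE => ws.
rewrite (bigD1 s) //= ltr_wpDr // sumr_ge0 // => t _; exact: weight_ge0.
Qed.

Local Notation mu := (mu S).
Local Notation E U g := (mu_given S U g).
Local Notation X g := (expect mu g).

Lemma mu_ge0 s : 0 <= mu s.
Proof. by rewrite divr_ge0 ?weight_ge0 // ltW // sum_weight_gt0. Qed.

Lemma mu_gt0 s : (0 < mu s) = (s \in Omega S).
Proof. by rewrite pmulr_lgt0 ?invr_gt0 ?sum_weight_gt0 // inE. Qed.

Lemma mu_eq0 s : s \notin Omega S -> mu s = 0.
Proof. by rewrite -mu_gt0 lt_neqAle mu_ge0 andbT negbK => /eqP <-. Qed.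

Lemma sum_mu : \sum_s mu s = 1.
Proof. by rewrite -mulr_suml mulfV // gt_eqF // sum_weight_gt0. Qed.

(** The probability of agreeing with s on U. *)
Definition pin_mass U s := \sum_(t | agree U s t) mu t.
Local Notation mass := pin_mass.

Lemma mass_gt0 U s : s \in Omega S -> 0 < mass U s.
Proof.
rewrite -mu_gt0 => ms; rewrite /pin_mass (bigD1 s) ?agree_refl //=.
by rewrite ltr_wpDr // sumr_ge0 // => t _; exact: mu_ge0.
Qed.

Lemma mass_agree U s t : agree U s t -> mass U s = mass U t.
Proof. by move=> st; apply: eq_bigl => r; exact: agree_eql. Qed.

Lemma mu_pin_restrict U s t :
  mu_pin S (Defs.restrict U s) t = if agree U s t then mu t / mass U s else 0.
Proof.
rewrite /mu_pin extends_restrict; case: ifP => // _; congr (_ / _).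
by apply: eq_bigl => r; rewrite extends_restrict.
Qed.

Lemma mu_givenE U g s :
  E U g s = (\sum_(t | agree U s t) mu t * g t) / mass U s.
Proof.
rewrite /mu_given /expect mulr_suml [RHS]big_mkcond /=; apply: eq_bigr => t _.
by rewrite mu_pin_restrict; case: ifP; rewrite ?mul0r // mulrAC.
Qed.

Lemma mu_given_agree U g s t : agree U s t -> E U g s = E U g t.
Proof. by move=> st; rewrite /mu_given (restrict_agree st). Qed.

Lemma mu_given_eq U g h s : (forall t, t \in Omega S -> agree U s t -> g t = h t) ->
  E U g s = E U h s.
Proof.
move=> gh; rewrite !mu_givenE; congr (_ / _); apply: eq_bigr => t st.
by have [/gh ->//|/mu_eq0 ->] := boolP (t \in Omega S); rewrite !mul0r.
Qed.

Lemma mu_given_le U g h s : s \in Omega S ->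
  (forall t, t \in Omega S -> agree U s t -> g t <= h t) -> E U g s <= E U h s.
Proof.
move=> sO gh; rewrite !mu_givenE ler_wpM2r ?invr_ge0 ?(ltW (mass_gt0 _ sO)) //.
apply: ler_sum => t st; have [/gh h'|/mu_eq0 ->] := boolP (t \in Omega S).
  by rewrite ler_wpM2l ?mu_ge0 ?h'.
by rewrite !mul0r.
Qed.

Lemma mu_givenD U g h s : E U (fun t => g t + h t) s = E U g s + E U h s.
Proof.
rewrite !mu_givenE -mulrDl -big_split /=; congr (_ / _).
by apply: eq_bigr => t _; rewrite mulrDr.
Qed.

Lemma mu_given_pull U g h s :
  (forall t, t \in Omega S -> agree U s t -> h t = h s) ->
  E U (fun t => h t * g t) s = h s * E U g s.
Proof.
move=> hs; rewrite !mu_givenE mulrA; congr (_ / _); rewrite mulr_sumr.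
apply: eq_bigr => t st; have [/hs ->//|/mu_eq0 ->] := boolP (t \in Omega S).
  by rewrite mulrCA.
by rewrite !mul0r mulr0.
Qed.

Lemma mu_givenZ U (c : R) g s : E U (fun t => c * g t) s = c * E U g s.
Proof. by rewrite (@mu_given_pull U g (fun=> c)). Qed.

Lemma mu_given1 U s : s \in Omega S -> E U (fun=> 1) s = 1.
Proof.
move=> sO; rewrite mu_givenE (eq_bigr mu) => [|t _]; last by rewrite mulr1.
by rewrite divff // gt_eqF // mass_gt0.
Qed.

Lemma mu_given_cst U (c : R) s : s \in Omega S -> E U (fun=> c) s = c.
Proof.
move=> sO; rewrite (@mu_given_eq _ _ (fun t => c * 1)) => [|t _ _]; last by rewrite mulr1.
by rewrite (@mu_given_pull U (fun=> 1) (fun=> c)) // mu_given1 ?mulr1.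
Qed.

Lemma mu_given_ge0 U g s : s \in Omega S ->
  (forall t, t \in Omega S -> 0 <= g t) -> 0 <= E U g s.
Proof.
by move=> sO g0; rewrite -(mu_given_cst U 0 sO); apply: mu_given_le => // t /g0.
Qed.

Lemma mu_given_setT g s : s \in Omega S -> E setT g s = g s.
Proof.
move=> sO; rewrite (@mu_given_eq _ _ (fun=> g s)) ?mu_given_cst // => t _ /agreeP h.
by congr g; apply/ffunP => x; rewrite h.
Qed.

(** Tower property in integrated form; it yields the tower property for nested
    conditionings and for the expectation under mu. *)
Lemma tower_sum U W g s : W \subset U ->
  \sum_(t | agree W s t) mu t * E U g t = \sum_(t | agree W s t) mu t * g t.
Proof.
move=> WU.
transitivity (\sum_(t | agree W s t) \sum_(r | agree U t r)
    mu t * (mu r * g r) / mass U t).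
  apply: eq_bigr => t _; rewrite mu_givenE mulrA mulr_sumr mulr_suml.
  by apply: eq_bigr => r _.
rewrite (exchange_big_dep (agree W s)) /=; last first.
  by move=> t r st /(agreeS WU); apply: agree_trans.
apply: eq_bigr => r sr.
have [rO|/mu_eq0 ->] := boolP (r \in Omega S); last first.
  by rewrite mul0r big1 // => t _; rewrite mulr0 mul0r.
transitivity (\sum_(t | agree U r t) mu t * (mu r * g r / mass U r)).
  apply: eq_big => t; last by move=> /andP[_ tr]; rewrite (mass_agree tr) -mulrA.
  rewrite (agree_sym U t r) andbC; have [rt|//] := boolP (agree U r t).
  by rewrite (agree_trans sr) // (agreeS WU).
by rewrite -mulr_suml -/(mass U r) mulrC divfK // gt_eqF // mass_gt0.
Qed.

Lemma tower U W g s : W \subset U -> E W (E U g) s = E W g s.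
Proof. by move=> WU; rewrite !mu_givenE tower_sum. Qed.

Lemma agree0 s t : agree set0 s t.
Proof. by apply/agreeP => x; rewrite inE. Qed.

Lemma expect_tower U g : X (E U g) = X g.
Proof.
have [s _] := set0Pn _ feas.
have h : agree set0 s =1 xpredT by move=> t; exact: agree0.
by have := @tower_sum U set0 g s (sub0set _); rewrite !(eq_bigl _ _ h).
Qed.

(** A factor h that depends on the spins in U only can be integrated against
    the conditional mean given those spins. *)
Lemma expect_pull U g h : (forall s t, agree U s t -> h s = h t) ->
  X (fun s => h s * g s) = X (fun s => h s * E U g s).
Proof.
move=> hd; rewrite -(expect_tower U); apply: eq_bigr => s _; congr (_ * _).
by apply: mu_given_pull => t _ st; rewrite (hd _ _ st).
Qed.

Lemma expect_eq g h : {in Omega S, g =1 h} -> X g = X h.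
Proof.
move=> gh; apply: eq_bigr => t _.
by have [/gh ->//|/mu_eq0 ->] := boolP (t \in Omega S); rewrite !mul0r.
Qed.

Lemma expect_le g h : (forall s, s \in Omega S -> g s <= h s) -> X g <= X h.
Proof.
move=> gh; apply: ler_sum => t _; have [/gh h'|/mu_eq0 ->] := boolP (t \in Omega S).
  by rewrite ler_wpM2l ?mu_ge0.
by rewrite !mul0r.
Qed.

Lemma expectD g h : X (fun s => g s + h s) = X g + X h.
Proof. by rewrite -big_split; apply: eq_bigr => s _; rewrite mulrDr. Qed.

Lemma expectB g h : X (fun s => g s - h s) = X g - X h.
Proof. by rewrite -sumrB; apply: eq_bigr => s _; rewrite mulrBr. Qed.

Lemma expectZ (c : R) g : X (fun s => c * g s) = c * X g.
Proof. by rewrite mulr_sumr; apply: eq_bigr => s _; rewrite mulrCA. Qed.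

Lemma expect_sum (I : finType) (P : pred I) (g : I -> config -> R) :
  X (fun s => \sum_(i | P i) g i s) = \sum_(i | P i) X (g i).
Proof.
by rewrite exchange_big; apply: eq_bigr => s _; rewrite mulr_sumr.
Qed.

Section Entropy.
Variable f : config -> R.
Hypothesis f_ge0 : forall s, s \in Omega S -> 0 <= f s.

(** The functional U |-> mu[f ln mu(f | sigma_U)], whose increments are the
    entropies of the statement. *)
Definition Hent U := X (fun s => f s * ln (E U f s)).

Lemma rho_ge0 U s : s \in Omega S -> 0 <= E U f s.
Proof. by move=> sO; exact: mu_given_ge0. Qed.

Lemma rho_eq0 U W s : W \subset U -> s \in Omega S -> E W f s = 0 -> E U f s = 0.
Proof.
move=> WU sO /eqP; rewrite mu_givenE mulf_eq0 invr_eq0 (gt_eqF (mass_gt0 W sO)) orbF.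
have h t : 0 <= mu t * f t.
  have [/f_ge0 h'|/mu_eq0 ->] := boolP (t \in Omega S); last by rewrite mul0r.
  by rewrite mulr_ge0 ?mu_ge0.
rewrite psumr_eq0 // => /allP h0; rewrite mu_givenE big1 ?mul0r // => t st.
apply/eqP; have := h0 t; rewrite mem_index_enum (agreeS WU st) /=; exact.
Qed.

Lemma rho_gt0 U W s : W \subset U -> s \in Omega S -> 0 < E U f s -> 0 < E W f s.
Proof.
move=> WU sO; rewrite !lt_neqAle !rho_ge0 // !andbT => h; apply: contra h.
by rewrite ![0 == _]eq_sym => /eqP/(rho_eq0 WU sO) ->.
Qed.

Lemma Hent_sub U W : W \subset U ->
  Hent U - Hent W = X (fun s => E U f s * ln (E U f s / E W f s)).
Proof.
move=> WU; rewrite -expectB.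
transitivity (X (fun s => ln (E U f s / E W f s) * f s)).
  apply: expect_eq => s sO /=.
  have [fz|fnz] := eqVneq (f s) 0; first by rewrite fz !mul0r subrr mulr0.
  have fp : 0 < E setT f s by rewrite mu_given_setT // lt_neqAle eq_sym fnz f_ge0.
  rewrite ln_div ?posrE; first by ring.
    by apply: rho_gt0 fp.
  by apply: rho_gt0 fp.
rewrite (@expect_pull U) => [|s t st].
  by apply: expect_eq => s _; rewrite mulrC.
by rewrite (mu_given_agree _ st) (mu_given_agree _ (agreeS WU st)).
Qed.

(** Subtracting the difference of the two conditional means, which has mean 0,
    makes the integrand nonnegative. *)
Lemma Hent_sub_centered U W : W \subset U ->
  Hent U - Hent W =
  X (fun s => E U f s * ln (E U f s / E W f s) - (E U f s - E W f s)).
Proof.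
by move=> WU; rewrite (Hent_sub WU) !expectB !expect_tower subrr subr0.
Qed.

Lemma Hent_gap_sqrt U W : W \subset U ->
  X (fun s => (Num.sqrt (E U f s) - Num.sqrt (E W f s)) ^+ 2) <= Hent U - Hent W.
Proof.
move=> WU; rewrite (Hent_sub_centered WU).
apply: expect_le => s sO; rewrite lerBrDl.
by apply: mul_ln_div_ge_sqrt; rewrite ?rho_ge0 //; exact: rho_eq0.
Qed.

Lemma Hent_mono U W : W \subset U -> Hent W <= Hent U.
Proof.
move=> WU; rewrite -subr_ge0; apply: le_trans (Hent_gap_sqrt WU).
by apply: sumr_ge0 => s _; rewrite mulr_ge0 ?mu_ge0 ?sqr_ge0.
Qed.

Lemma expect_rhoM W g :
  X (fun s => E W f s * g s) = X (fun s => E W f s * E W g s).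
Proof. by apply: expect_pull => s t st; rewrite (mu_given_agree _ st). Qed.

Lemma ent_mu_given U : ent S (E U f) = Hent U - Hent set0.
Proof.
rewrite (Hent_sub (sub0set U)); apply: expect_eq => s sO; congr (_ * ln (_ / _)).
rewrite expect_tower mu_givenE.
have -> : mass set0 s = 1.
  by rewrite -sum_mu; apply: eq_bigl => t; rewrite agree0.
by rewrite divr1; apply: eq_bigl => t; rewrite agree0.
Qed.

Lemma entE : ent S f = Hent setT - Hent set0.
Proof.
rewrite -ent_mu_given; have e : X (E setT f) = X f by exact: expect_tower.
by apply: expect_eq => s sO; rewrite e mu_given_setT.
Qed.

Lemma mean_ent_onE L : mean_ent_on S L f = Hent setT - Hent (~: L).
Proof.
rewrite (Hent_sub (subsetT _)); apply: expect_eq => s sO.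
by rewrite mu_given_setT.
Qed.

End Entropy.
End Conditioning.

(** * Covariances under a pinning *)

Section PinnedCovariance.
Variables (R : realType) (q : nat) (V bV : finType) (S : spin_system R q V bV).
Hypothesis feas : feasible S.
Local Notation config := (config q V).
Implicit Types (s t r : config) (U W : {set V}) (g h : config -> R) (x y : V).
Local Notation mu := (mu S).
Local Notation E U g := (mu_given S U g).

Lemma pinning_restrict W s : s \in Omega S -> pinning S (Defs.restrict W s).
Proof.
by move=> sO; apply/set0Pn; exists s; rewrite inE sO extends_restrict agree_refl.
Qed.

Variables (eta : R) (W : {set V}) (s : config).
Hypothesis sO : s \in Omega S.
Hypothesis SI : spectrally_independent S eta.

Let tau := Defs.restrict W s.
Local Notation P := (mu_pin S tau).
Implicit Types p : V * 'I_q.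

Lemma mu_pin_ge0 t : 0 <= P t.
Proof.
rewrite mu_pin_restrict; case: ifP => // _.
by rewrite divr_ge0 ?(mu_ge0 feas) ?(ltW (mass_gt0 feas W sO)).
Qed.

(** Marginals, joint probabilities and covariances of the indicators that a
    vertex has a given spin, under the pinned measure. As in the influence
    matrix, pcov is 0 for two indicators at the same vertex. *)
Definition pmarg p := prob P [pred t : config | t p.1 == p.2].
Definition pjoint p p' :=
  prob P [pred t : config | (t p.1 == p.2) && (t p'.1 == p'.2)].
Definition pcov p p' := if p.1 == p'.1 then 0 else pjoint p p' - pmarg p * pmarg p'.

Lemma pmarg_ge0 p : 0 <= pmarg p.
Proof. by apply: sumr_ge0 => t _; exact: mu_pin_ge0. Qed.

Lemma pjointC p p' : pjoint p p' = pjoint p' p.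
Proof. by apply: eq_bigl => t /=; rewrite andbC. Qed.

Lemma pcovC p p' : pcov p p' = pcov p' p.
Proof. by rewrite /pcov eq_sym pjointC mulrC. Qed.

Lemma pcov_eq0 p p' : pmarg p = 0 -> pcov p p' = 0.
Proof.
move=> p0; rewrite /pcov; case: ifP => // _; rewrite p0 mul0r subr0.
apply/eqP; rewrite eq_le; apply/andP; split; last first.
  by apply: sumr_ge0 => t _; exact: mu_pin_ge0.
rewrite -[leRHS]p0 /pjoint /pmarg /prob big_mkcondr /=; apply: ler_sum => t _.
by case: ifP => // _; exact: mu_pin_ge0.
Qed.

Lemma free_pairsE p : (p \in free_pairs S tau) = (p.1 \notin W) && (0 < pmarg p).
Proof.
by rewrite !inE /= /tau ffunE; case: (p.1 \in W).
Qed.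

(** The covariance form is bounded by eta times the marginals. The influence
    matrix is D^-1 C, with C the covariances and D the marginals, so it has the
    eigenvalues of the symmetric matrix D^-1/2 C D^-1/2, to which rayleigh_le
    applies. *)
Lemma pcov_form_le_free (phi : V * 'I_q -> R) :
  \sum_(p in free_pairs S tau) \sum_(p' in free_pairs S tau)
      phi p * phi p' * pcov p p' <=
  eta * \sum_(p in free_pairs S tau) phi p ^+ 2 * pmarg p.
Proof.
pose n := #|free_pairs S tau|.
pose d (i : 'I_n) := Num.sqrt (pmarg (enum_val i)).
have dp (i : 'I_n) : 0 < d i.
  by rewrite sqrtr_gt0; have := enum_valP i; rewrite free_pairsE => /andP[].
have dsq (i : 'I_n) : d i ^+ 2 = pmarg (enum_val i) by rewrite sqr_sqrtr // pmarg_ge0.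
pose A : 'M[R]_n := \matrix_(i, j) (pcov (enum_val i) (enum_val j) / (d i * d j)).
have Asym : A^T = A by apply/matrixP => i j; rewrite !mxE pcovC [d j * _]mulrC.
have eigA l : eigenvalue A l -> l <= eta.
  move=> /eigenvalueP[w wA w0]; apply: (SI (pinning_restrict W sO)).
  apply/eigenvalueP; exists (\row_i (w 0 i * d i)).
    apply/rowP => j; rewrite !mxE.
    have /rowP/(_ j) := wA; rewrite !mxE => e.
    rewrite mulrA -e mulr_suml; apply: eq_bigr => i _; rewrite !mxE.
    have -> : influence_coef S tau (enum_val i) (enum_val j) =
        pcov (enum_val i) (enum_val j) / d i ^+ 2.
      rewrite dsq /influence_coef /pcov; case: ifP => _; first by rewrite mul0r.
      rewrite -/(pjoint _ _) -/(pmarg _) -/(pmarg _) mulrBl [pmarg _ * _]mulrC mulfK //.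
      by rewrite -dsq expf_neq0 // gt_eqF.
    by field; rewrite !gt_eqF.
  apply: contra w0 => /eqP/rowP h; apply/eqP/rowP => i; have := h i.
  by rewrite !mxE => /eqP; rewrite mulf_eq0 (gt_eqF (dp i)) orbF => /eqP.
pose v : 'rV[R]_n := \row_i (d i * phi (enum_val i)).
have := rayleigh_le v Asym eigA.
have -> : (v *m A *m v^T) 0 0 = \sum_(p in free_pairs S tau)
    \sum_(p' in free_pairs S tau) phi p * phi p' * pcov p p'.
  rewrite exchange_big big_enum_val mxE; apply: eq_bigr => j _.
  rewrite !mxE mulr_suml [RHS]big_enum_val; apply: eq_bigr => i _; rewrite !mxE.
  by field; rewrite !gt_eqF.
congr (_ <= eta * _); rewrite mxE [RHS]big_enum_val; apply: eq_bigr => i _.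
by rewrite !mxE -dsq; ring.
Qed.

(** Pairs of probability 0 contribute nothing to either side. *)
Lemma pcov_form_le (phi : V * 'I_q -> R) :
  \sum_(p | p.1 \notin W) \sum_(p' | p'.1 \notin W) phi p * phi p' * pcov p p' <=
  eta * \sum_(p | p.1 \notin W) phi p ^+ 2 * pmarg p.
Proof.
have red (F : V * 'I_q -> R) : (forall p, pmarg p = 0 -> F p = 0) ->
    \sum_(p | p.1 \notin W) F p = \sum_(p in free_pairs S tau) F p.
  move=> F0; rewrite (bigID (fun p => 0 < pmarg p)) /= [X in _ + X]big1 ?addr0.
    by apply: eq_bigl => p; rewrite free_pairsE.
  move=> p /andP[_]; rewrite lt_neqAle pmarg_ge0 andbT negbK => /eqP e.
  by rewrite F0.
rewrite red => [|p p0]; last by rewrite big1 // => p' _; rewrite pcov_eq0 ?mulr0.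
rewrite [in leRHS]red => [|p ->]; last by rewrite mulr0.
apply: le_trans (pcov_form_le_free phi); rewrite le_eqVlt; apply/orP; left.
apply/eqP; apply: eq_bigr => p _; rewrite red // => p' p0.
by rewrite pcovC pcov_eq0 ?mulr0.
Qed.

Lemma expect_site (phi : V -> 'I_q -> R) x :
  \sum_t P t * phi x (t x) = \sum_a phi x a * pmarg (x, a).
Proof.
rewrite (partition_big (fun t : config => t x) xpredT) //=; apply: eq_bigr => a _.
by rewrite mulr_sumr; apply: eq_bigr => t /eqP ->; rewrite mulrC.
Qed.

Lemma expect_site2 (phi : V -> 'I_q -> R) x y :
  \sum_t P t * (phi x (t x) * phi y (t y)) =
  \sum_a \sum_a' phi x a * phi y a' * pjoint (x, a) (y, a').
Proof.
rewrite pair_big /=.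
rewrite (partition_big (fun t : config => (t x, t y)) xpredT) //=.
apply: eq_bigr => -[a a'] _ /=; rewrite mulr_sumr.
apply: eq_big => t; first by rewrite xpair_eqE.
by rewrite xpair_eqE => /andP[/eqP -> /eqP ->]; rewrite mulrC.
Qed.

Lemma site_cov_le (phi : V -> 'I_q -> R) :
  \sum_(x in ~: W) \sum_(y in ~: (x |: W))
     (\sum_t P t * (phi x (t x) * phi y (t y)) -
      (\sum_t P t * phi x (t x)) * (\sum_t P t * phi y (t y)))
  <= eta * \sum_(x in ~: W) \sum_t P t * phi x (t x) ^+ 2.
Proof.
have sumE (F : V * 'I_q -> R) :
    \sum_(p | p.1 \notin W) F p = \sum_(x in ~: W) \sum_a F (x, a).
  rewrite (pair_big (mem (~: W)) xpredT) /=; apply: eq_big => [[x a]|[x a] _] //=.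
  by rewrite !inE andbT.
have := pcov_form_le (fun p => phi p.1 p.2); rewrite !sumE /=.
have -> : \sum_(x in ~: W) \sum_a phi x a ^+ 2 * pmarg (x, a) =
          \sum_(x in ~: W) \sum_t P t * phi x (t x) ^+ 2.
  by apply: eq_bigr => x _; rewrite (expect_site (fun x a => phi x a ^+ 2)).
apply: le_trans; rewrite le_eqVlt; apply/orP; left; apply/eqP.
apply: eq_bigr => x xW; under [RHS]eq_bigr do rewrite sumE /=.
rewrite [RHS]exchange_big [RHS](bigD1 x) //= [X in _ = X + _]big1 ?add0r; last first.
  by move=> a _; rewrite big1 // => a' _; rewrite /pcov eqxx mulr0.
apply: eq_big => y; first by rewrite !inE negb_or andbC.
rewrite !inE negb_or => /andP[yx _].
rewrite expect_site2 !expect_site mulr_suml -sumrB.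
apply: eq_bigr => a _; rewrite mulr_sumr -sumrB; apply: eq_bigr => a' _.
rewrite /pcov /= eq_sym (negbTE yx); ring.
Qed.

End PinnedCovariance.

(** * The two-level inequality from spectral independence *)

Section TwoLevel.
Variables (R : realType) (q : nat) (V bV : finType) (S : spin_system R q V bV).
Hypothesis feas : feasible S.
Local Notation config := (config q V).
Implicit Types (s t r : config) (U W : {set V}) (g h : config -> R) (x y : V).
Local Notation mu := (mu S).
Local Notation E U g := (mu_given S U g).
Local Notation X g := (expect mu g).
Local Notation mass := (pin_mass S).

Variables (eta b : R).
Hypothesis SI : spectrally_independent S eta.
Hypothesis MB : marginally_bounded S b.

(** Spectral independence for observables phi x that depend on the spins in
    x |: W only. *)
Lemma mu_given_cov_le W s (phi : V -> config -> R) : s \in Omega S ->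
  (forall x t r, agree (x |: W) t r -> phi x t = phi x r) ->
  \sum_(x in ~: W) \sum_(y in ~: (x |: W))
    (E W (fun t => phi x t * phi y t) s - E W (phi x) s * E W (phi y) s)
  <= eta * \sum_(x in ~: W) E W (fun t => phi x t ^+ 2) s.
Proof.
move=> sO phiW.
(* phi x at a configuration agreeing with s on W is a function of the spin at x *)
pose upd x a : config := [ffun z => if z == x then a else s z].
pose psi x a := phi x (upd x a).
have psiE x t : x \notin W -> agree W s t -> phi x t = psi x (t x).
  move=> xW st; apply: phiW; rewrite agreeU1 ffunE !eqxx andbT.
  apply/agreeP => z zW; rewrite ffunE; have [e|_] := eqVneq z x.
    by rewrite -e zW in xW.
  by move/agreeP: st => /(_ z zW) ->.
have := site_cov_le feas W sO SI psi.
have eqE (F G : config -> R) : (forall t, agree W s t -> F t = G t) ->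
    \sum_t mu_pin S (Defs.restrict W s) t * F t = E W G s.
  by move=> FG; rewrite -(@mu_given_eq _ _ _ _ S feas W F G s) // => t _ /FG.
congr (_ <= eta * _); last first.
  by apply: eq_bigr => x; rewrite inE => xW; apply: eqE => t st; rewrite -psiE.
apply: eq_bigr => x; rewrite inE => xW; apply: eq_bigr => y.
rewrite !inE negb_or => /andP[_ yW].
congr (_ - _ * _); apply: eqE => t st; rewrite -?psiE //.
Qed.

(** Seen by testing the covariance bound on a single constant observable: a
    vertex has no influence on itself. *)
Lemma spectrally_independent_ge0 : (0 < #|V|)%N -> 0 <= eta.
Proof.
move=> /card_gt0P[x0 _]; have [s sO] := set0Pn _ feas.
pose phi x (t : config) : R := if x == x0 then 1 else 0.
have := @mu_given_cov_le set0 s phi sO (fun _ _ _ _ => erefl).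
rewrite [Z in Z <= _]big1 => [|x _]; last first.
  rewrite big1 // => y; rewrite !inE orbF => yx; rewrite /phi.
  case: (eqVneq x x0) => [e|_].
    by rewrite -e (negbTE yx) mulr0 !(mu_given_cst feas) // mulr0 subrr.
  by rewrite mul0r !(mu_given_cst feas) // mul0r subrr.
rewrite (bigD1 x0) ?inE //= big1 ?addr0 => [|x /andP[_ xx]]; last first.
  by rewrite /phi (negbTE xx) (mu_given_cst feas) // expr0n.
by rewrite /phi eqxx (mu_given_cst feas) // expr1n mulr1.
Qed.

Lemma mass_setU1_ge W x s : s \in Omega S -> b * mass W s <= mass (x |: W) s.
Proof.
move=> sO; have [b0 mb] := MB.
have pE : prob (mu_pin S (Defs.restrict W s)) [pred t : config | t x == s x] =
    mass (x |: W) s / mass W s.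
  rewrite /prob /pin_mass mulr_suml big_mkcond [RHS]big_mkcond /=.
  apply: eq_bigr => t _; rewrite mu_pin_restrict agreeU1 [s x == _]eq_sym.
  by case: (agree W s t); case: (t x == s x).
have m0 := mass_gt0 feas W sO; have m1 := mass_gt0 feas (x |: W) sO.
have := mb _ (pinning_restrict W sO) x (s x).
by rewrite inE pE divr_gt0 // => /(_ isT); rewrite ler_pdivlMr.
Qed.

Lemma marginal_bound_le1 : (0 < #|V|)%N -> b <= 1.
Proof.
move=> /card_gt0P[x _]; have [s sO] := set0Pn _ feas.
have := mass_setU1_ge set0 x sO; have m0 := mass_gt0 feas set0 sO.
have : mass (x |: set0) s <= mass set0 s.
  rewrite /pin_mass [leRHS]big_mkcond [leLHS]big_mkcond /=; apply: ler_sum => t _.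
  by rewrite agree0; case: ifP => // _; exact: (mu_ge0 feas).
move=> h1 h2; have := le_trans h2 h1.
by rewrite -[leRHS]mul1r ler_pM2r.
Qed.

Section Entropy.
Variable f : config -> R.
Hypothesis f_ge0 : forall s, s \in Omega S -> 0 <= f s.
Local Notation H := (Hent S f).
Local Notation rho U := (mu_given S U f).

(** The density F_x of f at the vertex x, relative to its conditional mean given
    the spins in W. It is 0 where that mean is 0. *)
Definition site_ratio W x s := rho (x |: W) s / rho W s.
Local Notation F := site_ratio.

Lemma site_ratio_ge0 W x s : s \in Omega S -> 0 <= F W x s.
Proof. by move=> sO; rewrite divr_ge0 // (rho_ge0 feas). Qed.

Lemma site_ratio_le W x s : s \in Omega S -> F W x s <= b^-1.
Proof.
move=> sO; have [b0 _] := MB.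
have [rz|rnz] := eqVneq (rho W s) 0.
  by rewrite /F rz invr0 mulr0 invr_ge0 ltW.
have rp : 0 < rho W s by rewrite lt_neqAle eq_sym rnz (rho_ge0 feas).
have m0 := mass_gt0 feas W sO; have m1 := mass_gt0 feas (x |: W) sO.
rewrite /F ler_pdivrMr // !mu_givenE ler_pdivrMr //.
have n0 t : 0 <= mu t * f t.
  have [/f_ge0 h'|/mu_eq0 -> //] := boolP (t \in Omega S); last by rewrite mul0r.
  by rewrite mulr_ge0 ?mu_ge0.
apply: (@le_trans _ _ (\sum_(t | agree W s t) mu t * f t)).
  rewrite [leRHS]big_mkcond [leLHS]big_mkcond /=; apply: ler_sum => t _.
  by rewrite agreeU1; case: (agree W s t) => //=; case: ifP.
set n := \sum_(_ | _) _; have nn : 0 <= n by apply: sumr_ge0.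
have := mass_setU1_ge W x sO; set m := mass W s; set m' := mass _ s => h.
have -> : b^-1 * (n / m) * m' = n * (m' / (b * m)) by field; rewrite !gt_eqF.
by rewrite -[leLHS]mulr1 ler_wpM2l // ler_pdivlMr ?mul1r // mulr_gt0.
Qed.

Lemma site_ratioM W x s : s \in Omega S -> rho W s * F W x s = rho (x |: W) s.
Proof.
move=> sO; rewrite /F; have [rz|rnz] := eqVneq (rho W s) 0.
  by rewrite rz mul0r (rho_eq0 feas f_ge0 (subsetUr _ _) sO rz).
by rewrite mulrC divfK.
Qed.

Lemma site_ratio_agree W x s t : agree (x |: W) s t -> F W x s = F W x t.
Proof.
move=> st; rewrite /F (mu_given_agree _ _ st).
by rewrite (mu_given_agree _ _ (agreeS (subsetUr _ _) st)).
Qed.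

Lemma site_ratio_mean W x s : s \in Omega S -> rho W s != 0 -> E W (F W x) s = 1.
Proof.
move=> sO rn; apply: (mulfI rn); rewrite mulr1.
rewrite -[RHS](tower feas f s (subsetUr [set x] W)).
transitivity (E W (fun t => rho W t * F W x t) s).
  by rewrite (mu_given_pull feas) // => t _ st; rewrite -(mu_given_agree _ _ st).
by apply: (mu_given_eq feas) => t tO _; rewrite site_ratioM.
Qed.

(** The integrand f ln rho of H is replaced by a nonnegative one. *)
Lemma Hent_gap_psi W x :
  H (x |: W) - H W = X (fun s => rho W s * (F W x s * ln (F W x s) - F W x s + 1)).
Proof.
rewrite (Hent_sub feas f_ge0 (subsetUr _ _)).
have <- : X (fun s => rho (x |: W) s * ln (F W x s)) +
          X (fun s => rho W s - rho (x |: W) s) =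
          X (fun s => rho (x |: W) s * ln (rho (x |: W) s / rho W s)).
  by rewrite expectB !(expect_tower feas) subrr addr0.
rewrite -expectD; apply: (expect_eq feas) => s sO.
rewrite -(site_ratioM W x sO); ring.
Qed.

Lemma Hent_gap_ln W x :
  H (x |: W) - H W = X (fun s => rho W s * (F W x s * ln (F W x s))).
Proof.
rewrite (Hent_sub feas f_ge0 (subsetUr _ _)); apply: (expect_eq feas) => s sO.
by rewrite mulrA site_ratioM.
Qed.

(** If truncating at M costs at most a fraction kappa of the entropy density,
    it costs at most that fraction of the increment of H. *)
Lemma expect_ln_min_ge (kappa M : R) W x :
  (forall z, 0 <= z <= b^-1 ->
     z * ln z - kappa * (z * ln z - z + 1) <= z * ln (Num.min z M)) ->
  (1 - kappa) * (H (x |: W) - H W) <= X (fun s => f s * ln (Num.min (F W x s) M)).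
Proof.
move=> h; rewrite mulrBl mul1r {1}Hent_gap_ln Hent_gap_psi -expectZ -expectB.
have -> : X (fun s => f s * ln (Num.min (F W x s) M)) =
          X (fun s => rho W s * (F W x s * ln (Num.min (F W x s) M))).
  transitivity (X (fun s => ln (Num.min (F W x s) M) * rho (x |: W) s)).
    rewrite -(expect_pull feas) => [|s t st]; last by rewrite (site_ratio_agree st).
    by apply: eq_bigr => s _; rewrite [f s * _]mulrC.
  by apply: (expect_eq feas) => s sO; rewrite -(site_ratioM W x sO); ring.
apply: (expect_le feas) => s sO.
rewrite [kappa * _]mulrCA -mulrBr ler_wpM2l ?(rho_ge0 feas) // h //.
by rewrite site_ratio_ge0 // site_ratio_le.
Qed.

(** The dual formula for the relative entropy of the pair (x, y), tested on the
    product of the truncated one-vertex densities. *)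
Lemma pair_gap_ge W x y M : 1 <= M -> x \in ~: W -> y \in ~: (x |: W) ->
  X (fun s => f s * ln (Num.min (F W x s) M)) + 
  X (fun s => f s * ln (Num.min (F W y s) M)) -
  X (fun s => rho W s * (Num.min (F W x s) M * Num.min (F W y s) M - 1))
  <= H (y |: (x |: W)) - H W.
Proof.
move=> M1; rewrite !inE negb_or => xW /andP[yx yW].
set U := y |: _; have WU : W \subset U by rewrite /U setUA subsetUr.
have xU : x |: W \subset U by rewrite subsetUr.
have yU : y |: W \subset U by rewrite /U setUCA subsetUr.
pose u x s := Num.min (F W x s) M.
have uA z : z |: W \subset U -> forall s t, agree U s t -> ln (u z s) = ln (u z t).
  by move=> zU s t st; rewrite /u (@site_ratio_agree _ _ s t) // (agreeS zU).
have fu z : z |: W \subset U ->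
    X (fun s => f s * ln (u z s)) = X (fun s => ln (u z s) * rho U s).
  move=> zU; rewrite -(@expect_pull _ _ _ _ _ feas U f _ (uA z zU)).
  by apply: eq_bigr => s _; rewrite [f s * _]mulrC.
rewrite (Hent_sub_centered feas f_ge0 WU) !fu // -expectD -expectB.
apply: (expect_le feas) => s sO.
have Fx0 := site_ratio_ge0 W x sO; have Fy0 := site_ratio_ge0 W y sO.
have ux0 : 0 <= u x s by rewrite /u le_min Fx0; lra.
have uy0 : 0 <= u y s by rewrite /u le_min Fy0; lra.
have rU := rho_ge0 feas f_ge0 U sO; have rW := rho_ge0 feas f_ge0 W sO.
rewrite -/(u x s) -/(u y s).
have [rz|rnz] := eqVneq (rho U s) 0.
  have := mulr_ge0 rW (mulr_ge0 ux0 uy0).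
  by rewrite rz !mul0r !mulr0; lra.
have rUp : 0 < rho U s by rewrite lt_neqAle eq_sym rnz.
have rWp : 0 < rho W s by apply: (rho_gt0 feas f_ge0 WU sO).
have rxp : 0 < rho (x |: W) s by apply: (rho_gt0 feas f_ge0 xU sO).
have ryp : 0 < rho (y |: W) s by apply: (rho_gt0 feas f_ge0 yU sO).
have uxp : 0 < u x s by rewrite /u lt_min divr_gt0 //=; lra.
have uyp : 0 < u y s by rewrite /u lt_min divr_gt0 //=; lra.
have gp : 0 < rho W s * (u x s * u y s) by rewrite !mulr_gt0.
have g0 : rho W s * (u x s * u y s) = 0 -> rho U s = 0.
  by move=> e; rewrite e ltxx in gp.
have := mul_ln_div_ge (ltW rUp) (ltW gp) g0.
rewrite 2?ln_div ?posrE // lnM ?posrE ?mulr_gt0 // lnM ?posrE //.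
move: (ln (rho U s)) (ln (rho W s)) (ln (u x s)) (ln (u y s)) => a1 a2 a3 a4.
move: (rho U s) (rho W s) (u x s) (u y s) => r1 r2 u1 u2; lra.
Qed.

(** Summing pair_gap_ge over x <> y. The truncated densities have conditional
    mean at most 1, so the defect of the product is at most a covariance. *)
Lemma two_level_trunc W M m : 1 <= M -> #|~: W| = m.+1 ->
  2 * m%:R * (\sum_(x in ~: W) X (fun s => f s * ln (Num.min (F W x s) M)))
  - 4 * M * eta * (\sum_(x in ~: W) (H (x |: W) - H W))
  <= \sum_(x in ~: W) \sum_(y in ~: (x |: W)) (H (y |: (x |: W)) - H W).
Proof.
move=> M1 cW.
pose u x s := Num.min (F W x s) M.
pose L x := X (fun s => f s * ln (u x s)).
pose Q x y := X (fun s => rho W s * (u x s * u y s - 1)).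
have eta0 : 0 <= eta.
  by apply: spectrally_independent_ge0; apply: leq_trans (max_card (mem (~: W))); rewrite cW.
have u0 x s : s \in Omega S -> 0 <= u x s.
  by move=> sO; rewrite /u le_min site_ratio_ge0 //; lra.
have QE x y : Q x y = X (fun s => rho W s * (E W (fun t => u x t * u y t) s - 1)).
  rewrite /Q (expect_rhoM feas); apply: (expect_eq feas) => s sO; congr (_ * _).
  by rewrite mu_givenD (mu_given_cst feas).
have pt s : s \in Omega S ->
   \sum_(x in ~: W) \sum_(y in ~: (x |: W))
      rho W s * (E W (fun t => u x t * u y t) s - 1) <=
   \sum_(x in ~: W) eta * (rho W s * E W (fun t => (u x t - 1) ^+ 2) s).
  move=> sO; have rW := rho_ge0 feas f_ge0 W sO.
  have [rz|rnz] := eqVneq (rho W s) 0.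
    rewrite !big1 // => x _; first by rewrite rz mul0r mulr0.
    by rewrite big1 // => y _; rewrite rz mul0r.
  have uA x t r : agree (x |: W) t r -> u x t - 1 = u x r - 1.
    by move=> tr; rewrite /u (site_ratio_agree tr).
  have Eu x : 0 <= E W (u x) s <= 1.
    rewrite (mu_given_ge0 feas) //=; last by move=> t; exact: u0.
    rewrite -(site_ratio_mean x sO rnz); apply: (mu_given_le feas) => // t _ _.
    by rewrite /u ge_min lexx.
  have := mu_given_cov_le sO uA; move/(ler_wpM2l rW).
  rewrite mulrA [rho W s * eta]mulrC -mulrA !mulr_sumr => h.
  apply: le_trans h; apply: ler_sum => x _; rewrite mulr_sumr.
  apply: ler_sum => y _; rewrite ler_wpM2l //.
  have E1 z : E W (fun t => u z t - 1) s = E W (u z) s - 1.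
    by rewrite mu_givenD (mu_given_cst feas).
  have -> : E W (fun t => (u x t - 1) * (u y t - 1)) s =
      E W (fun t => u x t * u y t) s - E W (u x) s - E W (u y) s + 1.
    rewrite (@mu_given_eq _ _ _ _ S feas W _
      (fun t => u x t * u y t + (-1 * u x t + (-1 * u y t + 1)))); last first.
      by move=> t _ _; ring.
    by rewrite !mu_givenD (mu_given_cst feas) // !(mu_givenZ feas); ring.
  rewrite !E1; have /andP[x0 x1] := Eu x; have /andP[y0 y1] := Eu y.
  nra.
have hQ : \sum_(x in ~: W) \sum_(y in ~: (x |: W)) Q x y <=
    4 * M * eta * (\sum_(x in ~: W) (H (x |: W) - H W)).
  have -> : \sum_(x in ~: W) \sum_(y in ~: (x |: W)) Q x y =
      X (fun s => \sum_(x in ~: W) \sum_(y in ~: (x |: W))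
          rho W s * (E W (fun t => u x t * u y t) s - 1)).
    rewrite expect_sum; apply: eq_bigr => x _; rewrite expect_sum.
    by apply: eq_bigr => y _; rewrite QE.
  apply: le_trans (expect_le feas pt) _; rewrite expect_sum mulr_sumr.
  apply: ler_sum => x _; rewrite expectZ -(expect_rhoM feas) Hent_gap_psi.
  rewrite [_ * eta]mulrC -mulrA.
  rewrite ler_wpM2l // -expectZ; apply: (expect_le feas) => s sO.
  rewrite [leRHS]mulrCA ler_wpM2l ?(rho_ge0 feas) //.
  by apply: sqr_min_sub1_le_psi => //; exact: site_ratio_ge0.
have big : \sum_(x in ~: W) \sum_(y in ~: (x |: W)) (L x + L y - Q x y)
  <= \sum_(x in ~: W) \sum_(y in ~: (x |: W)) (H (y |: (x |: W)) - H W).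
  by apply: ler_sum => x xW; apply: ler_sum => y yW; exact: pair_gap_ge.
apply: le_trans big.
have -> : \sum_(x in ~: W) \sum_(y in ~: (x |: W)) (L x + L y - Q x y) =
  2 * m%:R * (\sum_(x in ~: W) L x) - \sum_(x in ~: W) \sum_(y in ~: (x |: W)) Q x y.
  rewrite (eq_bigr (fun x => \sum_(y in ~: (x |: W)) L x +
     \sum_(y in ~: (x |: W)) L y - \sum_(y in ~: (x |: W)) Q x y)); last first.
    by move=> x _; rewrite sumrB big_split.
  rewrite sumrB big_split /=; congr (_ - _).
  rewrite (sum_pair_fst L cW) (sum_pair_snd L cW).
  by move: (\sum_(x in ~: W) L x) m%:R => z n; ring.
by move: hQ; rewrite -/(L _); lra.
Qed.

End Entropy.
End TwoLevel.

(** * The two-level inequality from connectivity *)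

Section Connectivity.
Variables (R : realType) (q : nat) (V bV : finType) (S : spin_system R q V bV).
Hypothesis feas : feasible S.
Local Notation config := (config q V).
Implicit Types (s t r : config) (U W : {set V}) (g h : config -> R) (x y : V).
Local Notation mu := (mu S).
Local Notation E U g := (mu_given S U g).
Local Notation X g := (expect mu g).
Local Notation mass := (pin_mass S).
Variable b : R.
Hypothesis TC : totally_connected S.
Hypothesis MB : marginally_bounded S b.

Section Pair.
Variables (W : {set V}) (x y : V) (s0 : config).
Hypothesis s0O : s0 \in Omega S.
Hypothesis yx : y != x.

Let U := y |: (x |: W).
Let spins (t : config) := (t x, t y).
Let fiber := Omega_pin S (Defs.restrict W s0).

Let fiberE t : (t \in fiber) = (t \in Omega S) && agree W s0 t.
Proof. by rewrite inE extends_restrict. Qed.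

Let agreeU t r : agree U t r = agree W t r && (spins t == spins r).
Proof. by rewrite !agreeU1 xpair_eqE andbA. Qed.

Let b_gt0 : 0 < b. Proof. by case: MB. Qed.

Let mass_pair t : t \in Omega S -> b ^+ 2 * mass W t <= mass U t.
Proof.
move=> tO; apply: le_trans (mass_setU1_ge feas MB (x |: W) y tO).
by rewrite expr2 -mulrA ler_wpM2l ?(mass_setU1_ge feas MB) // ltW.
Qed.

Let spin_pairs := [set spins t | t in fiber].

(** At most b^-2 pairs of spins at x, y are possible under the pinning. *)
Let card_spin_pairs : b ^+ 2 * #|spin_pairs|%:R <= 1.
Proof.
have m0 := mass_gt0 feas W s0O.
rewrite -(ler_pM2r m0) mul1r mulrAC mulr_natr -sumr_const.
apply: (@le_trans _ _ (\sum_(p in spin_pairs)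
    \sum_(r | agree W s0 r && (spins r == p)) mu r)).
  apply: ler_sum => p /imsetP[t]; rewrite fiberE => /andP[tO st] ->.
  rewrite (mass_agree _ st); apply: le_trans (mass_pair tO) _.
  rewrite /pin_mass le_eqVlt; apply/orP; left; apply/eqP; apply: eq_bigl => r.
  by rewrite agreeU (agree_eql _ st) eq_sym.
rewrite [leRHS](partition_big spins xpredT) //= [leRHS](bigID (mem spin_pairs)) /=.
rewrite lerDl; apply: sumr_ge0 => p _; apply: sumr_ge0 => r _; exact: mu_ge0.
Qed.

(** A nonnegative function of the spins in W and at x and y is, at each
    configuration possible under the pinning of W, at most b^-2 times its
    conditional mean given the pinning. *)
Lemma fiber_value_le (del : config -> R) t :
  (forall r r', agree U r r' -> del r = del r') ->
  (forall r, r \in Omega S -> 0 <= del r) -> t \in fiber ->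
  b ^+ 2 * del t <= E W del s0.
Proof.
move=> dU d0; rewrite fiberE => /andP[tO st].
have m0 := mass_gt0 feas W tO.
rewrite (mu_given_agree _ _ st) mu_givenE ler_pdivlMr // mulrAC.
apply: (le_trans (ler_wpM2r (d0 t tO) (mass_pair tO))).
rewrite /pin_mass mulr_suml big_mkcond [leRHS]big_mkcond /=; apply: ler_sum => r _.
rewrite agreeU; case: (boolP (agree W t r)) => //= tr.
case: eqP => [e|_]; first by rewrite (dU t r) // agreeU tr e eqxx.
have [/d0 h|/(mu_eq0 feas) ->] := boolP (r \in Omega S); last by rewrite mul0r.
by rewrite mulr_ge0 // mu_ge0.
Qed.

(** If phi depends on the spins at x and y, and changes by at most 2 d when only
    one of the two spins changes, then connectivity bounds its oscillation: a
    path of single-site moves projects to a walk on the at most b^-2 pairs of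
    spins, from which loops can be removed. *)
Lemma fiber_oscillation (phi : config -> R) (d : R) :
  0 <= d -> (forall r r', agree U r r' -> phi r = phi r') ->
  (forall r r', r \in fiber -> r' \in fiber -> r x = r' x \/ r y = r' y ->
     `|phi r - phi r'| <= 2 * d) ->
  forall s t, s \in fiber -> t \in fiber -> `|phi s - phi t| <= 2 * d / b ^+ 2.
Proof.
move=> d0 phiU phid s t sF tF.
have eqphi u v : u \in fiber -> v \in fiber -> spins u = spins v -> phi u = phi v.
  rewrite !fiberE => /andP[_ su] /andP[_ sv] e; apply: phiU.
  by rewrite agreeU -(agree_eql _ su) sv e eqxx.
pose e' : rel ('I_q * 'I_q) := [rel p p' | [exists u : config, exists v : config,
  [&& u \in fiber, v \in fiber, spins u == p, spins v == p'
    & (u x == v x) || (u y == v y)]]].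
have conn : connect e' (spins s) (spins t).
  have /connectP[ps] := TC (pinning_restrict W s0O) sF tF.
  elim: ps s sF => [|u ps IH] s sF /=; first by move=> _ ->; exact: connect0.
  move=> /andP[/and3P[_ uF /eqP h1] pu] lu.
  apply: connect_trans (IH u uF pu lu); apply: connect1.
  apply/existsP; exists s; apply/existsP; exists u; rewrite sF uF !eqxx /=.
  rewrite -[_ || _]negbK negb_or; apply/negP => /andP[nx ny].
  have : (2 <= hamming s u)%N.
    have <- : #|[set y; x]| = 2%N by rewrite cards2 yx.
    by rewrite subset_leq_card //; apply/subsetP => z /set2P[]->; rewrite inE.
  by rewrite h1.
have step ps u v : path e' (spins u) ps -> last (spins u) ps = spins v ->
    u \in fiber -> v \in fiber -> `|phi u - phi v| <= 2 * d *+ size ps.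
  elim: ps u => [|p ps IH] u /=.
    by move=> _ e uF vF; rewrite (eqphi u v) // subrr normr0 mulr0n.
  move=> /andP[/existsP[u1 /existsP[u2 /and5P[u1F u2F /eqP e1 /eqP e2 h]]] pp lp uF vF].
  rewrite (eqphi u u1) //; rewrite -e2 in pp lp.
  have -> : phi u1 - phi v = (phi u1 - phi u2) + (phi u2 - phi v) by ring.
  apply: le_trans (ler_normD _ _) _; rewrite mulrS lerD ?IH // phid //.
  by case/orP: h => /eqP; [left|right].
have /connectP[ps0 pp0 lp0] := conn.
case/shortenP: pp0 lp0 => ps pp up _ lp.
apply: le_trans (step ps s t pp (esym lp) sF tF) _.
rewrite -[leLHS]mulr_natr ler_wpM2l ?mulr_ge0 //.
rewrite -[_^-1]mul1r ler_pdivlMr ?exprn_gt0 // mulrC.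
apply: le_trans card_spin_pairs; rewrite ler_wpM2l ?exprn_ge0 ?(ltW b_gt0) //.
rewrite ler_nat.
have sub : {subset spins s :: ps <= spin_pairs}.
  move=> p; rewrite inE => /predU1P[->|]; first exact: imset_f.
  elim: ps (spins s) pp {up lp} => //= p1 ps IH p0 /andP[h pp].
  rewrite inE => /predU1P[->|]; last exact: IH pp.
  case/existsP: h => u1 /existsP[u2 /and5P[_ u2F _ /eqP <- _]].
  exact: imset_f.
apply: ltnW; rewrite -[leqLHS]/(size (spins s :: ps)) cardE.
by apply: uniq_leq_size up _ => p /sub; rewrite mem_enum.
Qed.

End Pair.

Section Entropy.
Variable f : config -> R.
Hypothesis f_ge0 : forall s, s \in Omega S -> 0 <= f s.
Local Notation H := (Hent S f).
Local Notation rho U := (mu_given S U f).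
Local Notation F := (site_ratio S f).

(** Both one-vertex densities are controlled by the distance D between the
    square roots of the pair density and of the one-vertex densities. *)
Lemma site_ratio_sqr_le W x y s0 : (0 < #|V|)%N -> s0 \in Omega S ->
  x \notin W -> y \notin x |: W ->
  rho W s0 != 0 ->
  let phi s := Num.sqrt (rho (y |: (x |: W)) s / rho W s) in
  let D := E W (fun s => (phi s - Num.sqrt (F W x s)) ^+ 2 +
                         (phi s - Num.sqrt (F W y s)) ^+ 2) s0 in
  E W (fun s => (F W x s - 1) ^+ 2) s0 <= 36 / b ^+ 7 * D /\
  E W (fun s => (F W y s - 1) ^+ 2) s0 <= 36 / b ^+ 7 * D.
Proof.
move=> V0 sO xW; rewrite !inE negb_or => /andP[yx yW] rn phi D.
have b0 : 0 < b by case: MB.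
have b1 : b <= 1 := marginal_bound_le1 feas MB V0.
set U := y |: (x |: W) in phi D *.
have xU : x |: W \subset U by rewrite subsetUr.
have yU : y |: W \subset U by rewrite /U setUCA subsetUr.
have WU : W \subset U by apply: subset_trans xU; rewrite subsetUr.
pose del s := (phi s - Num.sqrt (F W x s)) ^+ 2 + (phi s - Num.sqrt (F W y s)) ^+ 2.
have phiU r r' : agree U r r' -> phi r = phi r'.
  move=> h; rewrite /phi (mu_given_agree _ _ h).
  by rewrite (mu_given_agree _ _ (agreeS WU h)).
have FU z r r' : z |: W \subset U -> agree U r r' -> F W z r = F W z r'.
  by move=> zU h; apply: site_ratio_agree; exact: agreeS h.
have delU r r' : agree U r r' -> del r = del r'.
  by move=> h; rewrite /del (phiU _ _ h) (FU x _ _ xU h) (FU y _ _ yU h).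
have del0 r : 0 <= del r by rewrite addr_ge0 ?sqr_ge0.
have D0 : 0 <= D by apply: (mu_given_ge0 feas) => // t _; exact: del0.
set fib := Omega_pin S (Defs.restrict W s0).
have fibP t : t \in fib -> t \in Omega S /\ agree W s0 t.
  by rewrite inE extends_restrict => /andP[].
pose d := Num.sqrt D / b.
have d0 : 0 <= d by rewrite divr_ge0 ?sqrtr_ge0 // ltW.
have d2 : d ^+ 2 = D / b ^+ 2 by rewrite expr_div_n sqr_sqrtr.
have deld t : t \in fib -> del t <= d ^+ 2.
  move=> tF; rewrite d2 ler_pdivlMr ?exprn_gt0 // mulrC.
  by apply: (fiber_value_le delU _ tF) => r _; exact: del0.
have near t : t \in fib -> `|phi t - Num.sqrt (F W x t)| <= d /\
                           `|phi t - Num.sqrt (F W y t)| <= d.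
  move=> /deld h; rewrite -!(ler_sqr (normr_ge0 _)) ?nnegrE //.
  rewrite !real_normK ?num_real //; rewrite /del in h.
  split; apply: le_trans h; [rewrite lerDl | rewrite lerDr]; exact: sqr_ge0.
have osc s t : s \in fib -> t \in fib -> `|phi s - phi t| <= 2 * d / b ^+ 2.
  apply: (fiber_oscillation sO yx d0 phiU) => r r' rF r'F h.
  have [n1 n2] := near r rF; have [n3 n4] := near r' r'F.
  have [_ a1] := fibP r rF; have [_ a2] := fibP r' r'F.
  have a : agree W r r' by rewrite -(agree_eql _ a1).
  case: h => h.
    have e : F W x r = F W x r' by apply: site_ratio_agree; rewrite agreeU1 a h eqxx.
    by rewrite e in n1; exact: ler_dist2 n1 n3.
  have e : F W y r = F W y r' by apply: site_ratio_agree; rewrite agreeU1 a h eqxx.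
  by rewrite e in n2; exact: ler_dist2 n2 n4.
pose K := 2 * d / b ^+ 2.
have K0 : 0 <= K by apply: divr_ge0; [rewrite mulr_ge0 | rewrite exprn_ge0 // ltW].
have Ephi : E W (fun s => phi s ^+ 2) s0 = 1.
  apply: (mulfI rn); rewrite mulr1 -[RHS](tower feas f s0 WU).
  transitivity (E W (fun t => rho W t * phi t ^+ 2) s0).
    by rewrite (mu_given_pull feas) // => t _ st; rewrite -(mu_given_agree _ _ st).
  apply: (mu_given_eq feas) => t tO st.
  rewrite sqr_sqrtr ?divr_ge0 ?(rho_ge0 feas) //.
  by rewrite mulrC divfK // -(mu_given_agree _ _ st).
have phi1 s : s \in fib -> `|phi s - 1| <= K.
  move=> sF; rewrite ler_norml; apply/andP; split.
    have : 1 <= (phi s + K) ^+ 2.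
      rewrite -Ephi -(mu_given_cst feas W ((phi s + K) ^+ 2) sO).
      apply: (mu_given_le feas) => // t tO st.
      have tF : t \in fib by rewrite inE extends_restrict tO.
      have := osc s t sF tF; rewrite ler_norml => /andP[h1 h2].
      by rewrite lerXn2r ?nnegrE ?addr_ge0 ?sqrtr_ge0 //; rewrite -/K in h1 h2; lra.
    have : 0 <= phi s by exact: sqrtr_ge0.
    by move: (phi s) => p p0; nra.
  have [h|h] := leP (phi s) K; first lra.
  have : (phi s - K) ^+ 2 <= 1.
    rewrite -Ephi -(mu_given_cst feas W ((phi s - K) ^+ 2) sO).
    apply: (mu_given_le feas) => // t tO st.
    have tF : t \in fib by rewrite inE extends_restrict tO.
    have := osc s t sF tF; rewrite ler_norml => /andP[h1 h2].
    by rewrite lerXn2r ?nnegrE ?sqrtr_ge0 //; rewrite -/K in h1 h2; lra.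
  by move: (phi s) h => p h; nra.
have fin z : (forall t, t \in fib -> `|phi t - Num.sqrt (F W z t)| <= d) ->
    E W (fun s => (F W z s - 1) ^+ 2) s0 <= 36 / b ^+ 7 * D.
  move=> nz; rewrite -(mu_given_cst feas W (36 / b ^+ 7 * D) sO).
  apply: (mu_given_le feas) => // t tO st.
  have tF : t \in fib by rewrite inE extends_restrict tO.
  have := phi1 t tF; have := nz t tF; rewrite !ler_norml => /andP[h1 h2] /andP[h3 h4].
  have ib : 1 <= b^-1 by rewrite -invr1 lef_pV2 ?posrE.
  apply: le_trans (sqr_sub1_le (site_ratio_ge0 feas f_ge0 W z tO)
     (site_ratio_le feas MB f_ge0 W z tO) ib) _.
  have dK : d + K <= 3 * d / b ^+ 2.
    rewrite /K; have : d <= d / b ^+ 2.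
      by rewrite ler_pdivlMr ?exprn_gt0 // ler_piMr // expr_le1 // ltW.
    by lra.
  have -> : 36 / b ^+ 7 * D = 4 * b^-1 * (3 * d / b ^+ 2) ^+ 2.
    transitivity (36 * d ^+ 2 / b ^+ 5); first by rewrite d2; field; rewrite gt_eqF.
    by move: (d) => e; field; rewrite gt_eqF.
  rewrite ler_wpM2l ?mulr_ge0 ?invr_ge0 ?(ltW b0) //.
  rewrite -[leRHS]real_normK ?num_real // -[leLHS]real_normK ?num_real //.
  rewrite lerXn2r ?nnegrE // [leRHS]ger0_norm; last by lra.
  by rewrite ler_norml; apply/andP; split; lra.
by split; apply: fin => t /near[].
Qed.

(** A fixed fraction, depending on b only, of the entropy at x or at y is seen
    in the conditional entropies of the pair. *)
Lemma pair_gap_connected W x y : (0 < #|V|)%N -> x \in ~: W -> y \in ~: (x |: W) ->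
  b ^+ 7 / 36 * (H (x |: W) - H W) <=
    (H (y |: (x |: W)) - H (x |: W)) + (H (y |: (x |: W)) - H (y |: W)) /\
  b ^+ 7 / 36 * (H (y |: W) - H W) <=
    (H (y |: (x |: W)) - H (x |: W)) + (H (y |: (x |: W)) - H (y |: W)).
Proof.
move=> V0; rewrite inE => xW; rewrite inE => yW.
have b0 : 0 < b by case: MB.
set U := y |: (x |: W).
have xU : x |: W \subset U by rewrite subsetUr.
have yU : y |: W \subset U by rewrite /U setUCA subsetUr.
have WU : W \subset U by apply: subset_trans xU; rewrite subsetUr.
pose phi s := Num.sqrt (rho U s / rho W s).
pose del s := (phi s - Num.sqrt (F W x s)) ^+ 2 + (phi s - Num.sqrt (F W y s)) ^+ 2.
have rdel z : z |: W \subset U ->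
    X (fun s => rho W s * (phi s - Num.sqrt (F W z s)) ^+ 2) <= H U - H (z |: W).
  move=> zU; apply: le_trans (Hent_gap_sqrt feas f_ge0 zU); rewrite le_eqVlt; apply/orP; left.
  apply/eqP; apply: (expect_eq feas) => s sO.
  have rW := rho_ge0 feas f_ge0 W sO.
  rewrite -{1}[rho W s]sqr_sqrtr // -exprMn mulrBr -!sqrtrM //.
  rewrite (site_ratioM feas f_ge0 W z sO); congr ((Num.sqrt _ - _) ^+ 2).
  have [rz|rnz] := eqVneq (rho W s) 0.
    by rewrite rz mul0r (rho_eq0 feas f_ge0 WU sO rz).
  by rewrite mulrC divfK.
have tot : X (fun s => rho W s * del s) <= (H U - H (x |: W)) + (H U - H (y |: W)).
  apply: le_trans (lerD (rdel x xU) (rdel y yU)); rewrite -expectD.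
  by apply: (expect_le feas) => s sO; rewrite /del mulrDr.
have main z : (forall s, s \in Omega S -> rho W s != 0 ->
     E W (fun t => (F W z t - 1) ^+ 2) s <= 36 / b ^+ 7 * E W del s) ->
   b ^+ 7 / 36 * (H (z |: W) - H W) <= X (fun s => rho W s * del s).
  move=> h; rewrite Hent_gap_psi //.
  have c0 : 0 < b ^+ 7 / 36 by rewrite divr_gt0 // exprn_gt0.
  rewrite mulrC -ler_pdivlMr // [leRHS]mulrC -expectZ.
  apply: (@le_trans _ _ (X (fun s => rho W s * E W (fun t => (F W z t - 1) ^+ 2) s))).
    rewrite -(expect_rhoM feas); apply: (expect_le feas) => s sO.
    by rewrite ler_wpM2l ?(rho_ge0 feas) // psi_le_sqr // (site_ratio_ge0 feas).
  rewrite expectZ (expect_rhoM feas f W del) -expectZ; apply: (expect_le feas) => s sO.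
  have [->|rn] := eqVneq (rho W s) 0; first by rewrite !mul0r mulr0.
  rewrite mulrCA ler_wpM2l ?(rho_ge0 feas) // invf_div; exact: h.
split; apply: le_trans tot; apply: main => s sO rn.
  by have [] := site_ratio_sqr_le V0 sO xW yW rn.
by have [] := site_ratio_sqr_le V0 sO xW yW rn.
Qed.

Lemma two_level_connected W m : #|~: W| = m.+1 ->
  (1 + b ^+ 7 / 72) * (m%:R * \sum_(x in ~: W) (H (x |: W) - H W)) <=
  \sum_(x in ~: W) \sum_(y in ~: (x |: W)) (H (y |: (x |: W)) - H W).
Proof.
move=> cW.
have V0 : (0 < #|V|)%N by apply: leq_trans (max_card (mem (~: W))); rewrite cW.
pose e x := H (x |: W) - H W; set k := 1 + _.
rewrite -[Z in k * (_ * Z)]/(\sum_(x in ~: W) e x).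
have -> : k * (m%:R * \sum_(x in ~: W) e x) =
    \sum_(x in ~: W) \sum_(y in ~: (x |: W)) k / 2 * (e x + e y).
  transitivity (k / 2 * (\sum_(x in ~: W) \sum_(y in ~: (x |: W)) e x +
                         \sum_(x in ~: W) \sum_(y in ~: (x |: W)) e y)).
    rewrite (sum_pair_fst e cW) (sum_pair_snd e cW).
    by move: (\sum_(x in ~: W) e x) k m%:R => z k0 n; field.
  rewrite -big_split mulr_sumr; apply: eq_bigr => x _.
  by rewrite -big_split mulr_sumr.
apply: ler_sum => x xW; apply: ler_sum => y yW.
have [hx hy] := pair_gap_connected V0 xW yW.
move: (lerD hx hy) => {hx hy}; rewrite /k /e; move: (b ^+ 7) (H W) (H (x |: W)).
move: (H (y |: W)) (H (y |: (x |: W))) => hy hxy a h hx; lra.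
Qed.

End Entropy.
End Connectivity.

(** * Entropy factorization *)

Section AverageCard.
Variables (R : realType) (V : finType).
Implicit Types (G : {set V} -> R) (l : nat).

Lemma average_card_cst (a : R) l : (l <= #|V|)%N ->
  average_card l (fun _ : {set V} => a) = a.
Proof.
move=> lV; rewrite /average_card sumr_const -[#|_|]cardsE -[a *+ _]mulr_natr mulfK //.
by rewrite card_draws pnatr_eq0 -lt0n bin_gt0.
Qed.

Lemma average_cardB (G1 G2 : {set V} -> R) l :
  average_card l (fun U => G1 U - G2 U) = average_card l G1 - average_card l G2.
Proof. by rewrite /average_card sumrB mulrBl. Qed.

Lemma eq_average_card (G1 G2 : {set V} -> R) l : G1 =1 G2 ->
  average_card l G1 = average_card l G2.
Proof. by move=> e; rewrite /average_card (eq_bigr _ (fun U _ => e U)). Qed.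

Lemma average_cardC (G : {set V} -> R) l : (l <= #|V|)%N ->
  average_card l (fun L => G (~: L)) = average_card (#|V| - l) G.
Proof.
move=> lV; rewrite /average_card !card_draws bin_sub //; congr (_ / _).
rewrite [RHS](reindex_inj (@setC_inj V)); apply: eq_bigl => U.
have -> : #|~: U| = (#|V| - #|U|)%N by rewrite -(cardsC U) addKn.
have UV := max_card (mem U); apply/eqP/eqP => [->//|h].
by rewrite -(subKn UV) h subKn.
Qed.
End AverageCard.

Section Main.
Variables (R : realType) (q : nat) (V bV : finType) (S : spin_system R q V bV).
Variables (eta b : R).
Hypothesis feas : feasible S.
Hypothesis TC : totally_connected S.
Hypothesis SI : spectrally_independent S eta.
Hypothesis MB : marginally_bounded S b.
Variable f : config q V -> R.
Hypothesis f_ge0 : forall s, s \in Omega S -> 0 <= f s.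
Local Notation H := (Hent S f).
Local Notation T := (layer_avg H).
Implicit Types (W : {set V}) (N : nat).

Let b_gt0 : 0 < b. Proof. by case: MB. Qed.

Lemma Hent_setU1 W x : H W <= H (x |: W).
Proof. by apply: (Hent_mono feas f_ge0); rewrite subsetUr. Qed.

Let card_V_gt0 W N : #|~: W| = N.+1 -> (0 < #|V|)%N.
Proof. by move=> cW; apply: leq_trans (max_card (mem (~: W))); rewrite cW. Qed.

(** two_level_trunc in terms of layer averages. *)
Lemma two_level_avg (kappa M : R) W N : 1 <= M -> #|~: W| = N.+2 ->
  (forall z, 0 <= z <= b^-1 ->
     z * ln z - kappa * (z * ln z - z + 1) <= z * ln (Num.min z M)) ->
  (2 * (1 - kappa) - 4 * M * (eta / N.+1%:R)) * (T 1 W - H W) <= T 2 W - H W.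
Proof.
move=> M1 cW h.
have := two_level_trunc feas SI f_ge0 M1 cW.
rewrite (layer_avg2_gap H cW) (layer_avg1_gap H cW).
have : N.+2%:R * ((1 - kappa) * (T 1 W - H W)) <= \sum_(x in ~: W)
    expect (mu S) (fun s => f s * ln (Num.min (site_ratio S f W x s) M)).
  rewrite mulrCA -(layer_avg1_gap H cW) mulr_sumr; apply: ler_sum => x _.
  exact: (expect_ln_min_ge feas MB f_ge0).
have n1 : 0 < N.+1%:R :> R by rewrite ltr0n.
have n2 : 0 < N.+2%:R :> R by rewrite ltr0n.
move: (\sum_(_ in _) _) N.+1%:R N.+2%:R n1 n2 => L m n m0 n0 hL {cW h} hh.
move: (T 1 W - H W) (T 2 W - H W) hL hh => t1 t2 hL hh.
have : 2 * m * (n * ((1 - kappa) * t1)) <= 2 * m * L.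
  by rewrite ler_wpM2l // mulr_ge0 // ltW.
move=> h2; have h3 := le_trans (lerB h2 (lexx (4 * M * eta * (n * t1)))) hh.
rewrite -(ler_pM2l m0) -(ler_pM2l n0); apply: le_trans h3.
rewrite le_eqVlt; apply/orP; left; apply/eqP; field.
by rewrite gt_eqF.
Qed.

(** The level M = 1/b is never exceeded, so nothing is lost by truncating. *)
Lemma two_level_spectral W N : #|~: W| = N.+2 ->
  (2 - 4 * (eta / b) / N.+1%:R) * (T 1 W - H W) <= T 2 W - H W.
Proof.
move=> cW; have b1 : 1 <= b^-1.
  by rewrite -invr1 lef_pV2 ?posrE ?(marginal_bound_le1 feas MB (card_V_gt0 cW)).
have := @two_level_avg 0 b^-1 W N b1 cW.
have -> : 2 * (1 - 0) - 4 * b^-1 * (eta / N.+1%:R) = 2 - 4 * (eta / b) / N.+1%:R by ring.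
by apply=> z /andP[z0 zb]; rewrite (min_idPl zb) mul0r subr0.
Qed.

(** With s = eta/b and m free vertices besides one: for m >= 8 s the spectral
    bound suffices; for m < 8 s either truncation leaves E_2 >= 3/2 E_1, or b is
    so large that the connectivity bound suffices. *)
Lemma layer1_le_powR W N : #|~: W| = N.+2 ->
  T 1 W - H W <= (1 - (N.+1%:R / (N.+1%:R + 1)) `^ (1 + 4096 * (eta / b))) *
                 (H setT - H W).
Proof.
move=> cW; have V0 := card_V_gt0 cW.
have s0 : 0 <= eta / b by rewrite divr_ge0 ?(spectrally_independent_ge0 feas SI V0) // ltW.
have m1 : 1 <= N.+1%:R :> R by rewrite ler1n.
have E0 : 0 <= T 1 W - H W by rewrite subr_ge0 (le_layer_avg1 Hent_setU1 cW).
have D0 : 0 <= H setT - H W by rewrite subr_ge0 (le_setT Hent_setU1).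
have T2 : T 2 W - H W <= H setT - H W.
  by rewrite lerD2r (layer_avg_le_setT Hent_setU1) // cW.
have [large|small] := leP (8 * (eta / b)) N.+1%:R.
  have c0 : 0 <= 4 * (eta / b) by rewrite mulr_ge0.
  apply: le_trans (layer1_le Hent_setU1 c0 two_level_spectral cW) _.
  rewrite ler_wpM2r // -[N.+2%:R]natr1.
  have := @powR_ratio_large R (eta / b) N.+1%:R 4096 _ s0 m1 large.
  have -> : (1 + 4 * (eta / b)) / (N.+1%:R + 1) =
     1 - (N.+1%:R - 4 * (eta / b)) / (N.+1%:R + 1).
    by move: N.+1%:R m1 => n n1; field; clear cW; apply/andP; split; rewrite gt_eqF //; lra.
  by move=> h; rewrite lerD2l lerN2; apply: h; lra.
have [mid|crude] := leP (4 * (16 * (eta / b / N.+1%:R)) ^+ 9) b^-1.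
  have [M1 lM] := trunc_level b_gt0 m1 small mid.
  set M := _^-1 in M1 lM.
  have tr z : 0 <= z <= b^-1 ->
     z * ln z - 8^-1 * (z * ln z - z + 1) <= z * ln (Num.min z M).
    by move=> /andP[z0 zb]; rewrite [8^-1 * _]mulrC; exact: mul_ln_min_ge zb M1 lM.
  have := two_level_avg M1 cW tr.
  have -> : 2 * (1 - 8^-1) - 4 * M * (eta / N.+1%:R) = 3 / 2.
    rewrite /M; have sp : 0 < eta / b by lra.
    have ep : 0 < eta by move: sp; rewrite pmulr_lgt0 // invr_gt0.
    move: N.+1%:R m1 => n n1; have n0 : 0 < n by lra.
    by field; rewrite !gt_eqF.
  have K48 : 48 <= 4096 :> R by rewrite ler_nat.
  move=> h; have p := powR_ratio_small K48 s0 m1 small.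
  move: (_ `^ _) (T 1 W - H W) (T 2 W - H W) (H setT - H W) p h E0 D0 T2.
  move=> P t1 t2 D p h E0 D0 T2.
  apply: (@le_trans _ _ (3 / 4 * D)); first by lra.
  by rewrite ler_wpM2r //; lra.
have p := @powR_ratio_crude R _ _ 4096 b _ s0 m1 small b_gt0 (ltW crude).
have {}p := p (lexx _).
have b1 := marginal_bound_le1 feas MB V0.
have := two_level_connected feas TC MB f_ge0 cW.
rewrite (layer_avg2_gap H cW) (layer_avg1_gap H cW).
have n2 : 0 < N.+2%:R :> R by rewrite ltr0n.
have n1 : 0 < N.+1%:R :> R by lra.
rewrite [X in _ * X](mulrCA N.+1%:R) [leLHS]mulrCA (ler_pM2l n2) [leLHS]mulrCA.
rewrite (ler_pM2l n1) => h.
have a0 : 0 < b ^+ 7 by rewrite exprn_gt0.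
have a1 : b ^+ 7 <= 1 by rewrite exprn_ile1 // ltW.
move: (_ `^ _) (b ^+ 7) (T 1 W - H W) (T 2 W - H W) (H setT - H W) p a0 a1 h
  T2 E0 D0.
move=> P a t1 t2 D p a0 a1 h T2 E0 D0.
apply: (@le_trans _ _ ((1 - a / 256) * D)); last first.
  by rewrite ler_wpM2r //; lra.
have : (1 - a / 256) * ((1 + a / 72) * t1) <= (1 - a / 256) * D.
  by rewrite ler_wpM2l //; lra.
have : 0 <= (1 / 72 - 1 / 256 - a / 256 / 72) * a * t1.
  by rewrite !mulr_ge0 //; lra.
by lra.
Qed.

Lemma ent_average_le l : (1 <= l <= #|V| - 1)%N ->
  #|V|%:R / l%:R * average_card l (fun U => ent S (mu_given S U f))
    <= (1 + 4 * (eta / b)) * ent S f.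
Proof.
case/andP=> l1 lV; have lV' : (l <= #|V|)%N by apply: leq_trans lV (leq_subr _ _).
have V0 : (0 < #|V|)%N by apply: leq_trans lV'.
have s0 : 0 <= 4 * (eta / b).
  by rewrite mulr_ge0 // divr_ge0 ?(spectrally_independent_ge0 feas SI V0) // ltW.
rewrite (eq_average_card l (ent_mu_given feas f_ge0)) average_cardB.
rewrite average_card_cst // average_card_layer // (entE feas f_ge0).
case cV : #|V| V0 lV' => [//|N] _ lN.
have c0 : #|~: set0 : {set V}| = N.+1 by rewrite setC0 cardsT.
have l1N : (1 <= l <= N.+1)%N by rewrite l1.
have l0 : 0 < l%:R :> R by rewrite ltr0n.
have N0 : 0 < N.+1%:R :> R by rewrite ltr0n.
have k0 : 0 <= N.+1%:R / l%:R :> R by rewrite divr_ge0 // ltW.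
have := layer_le Hent_setU1 s0 two_level_spectral c0 l1N.
move=> /(ler_wpM2l k0) h; apply: le_trans h _; rewrite [leLHS]mulrA ler_wpM2r //.
  by rewrite subr_ge0 (le_setT Hent_setU1).
by rewrite mulrCA -[l%:R / _]invf_div divff ?mulr1 // gt_eqF // divr_gt0.
Qed.

Lemma ent_le_average_mean (theta : R) l : 0 < theta <= 1 ->
  l%:Z = Num.ceil (theta * #|V|%:R) ->
  l%:R / #|V|%:R * ent S f
   <= (1 / theta) `^ (4096 * (eta / b)) *
      average_card l (fun L => mean_ent_on S L f).
Proof.
move=> /andP[th0 th1] lE.
rewrite (eq_average_card l (mean_ent_onE feas f_ge0)) (entE feas f_ge0).
have [V0|V0] := posnP #|V|.
  rewrite V0 invr0 mulr0 mul0r mulr_ge0 ?powR_ge0 //.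
  rewrite /average_card divr_ge0 // sumr_ge0 // => L _.
  by rewrite subr_ge0 (le_setT Hent_setU1).
have n0 : 0 < #|V|%:R :> R by rewrite ltr0n.
have tn0 : 0 < theta * #|V|%:R by rewrite mulr_gt0.
have lge : theta * #|V|%:R <= l%:R.
  by have := Num.Theory.ceil_ge (theta * #|V|%:R); rewrite -lE.
have l0 : 0 < l%:R :> R by lra.
have l1 : (1 <= l)%N by rewrite -(ltr0n R).
have lV : (l <= #|V|)%N.
  rewrite -lez_nat lE ceil_le_int; rewrite -[leRHS]mul1r ler_wpM2r //.
have s0 : 0 <= eta / b by rewrite divr_ge0 ?(spectrally_independent_ge0 feas SI V0) // ltW.
rewrite average_cardB average_card_cst // average_cardC //.
rewrite average_card_layer ?leq_subr //.
set K := 4096 * (eta / b).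
have K0 : 0 <= K by rewrite mulr_ge0.
have p0 : 0 <= 1 + K by lra.
have c0 : #|~: set0 : {set V}| = #|V| by rewrite setC0 cardsT.
have lN : (1 <= l <= #|V|)%N by rewrite l1.
have := layer_gap_ge p0 layer1_le_powR c0 lN.
set D := H setT - H set0; set G := H setT - _ => h.
have G0 : 0 <= G.
  by rewrite subr_ge0 (layer_avg_le_setT Hent_setU1) // c0 leq_subr.
apply: (@le_trans _ _ ((#|V|%:R / l%:R) `^ K * G)); last first.
  rewrite ler_wpM2r // ge0_ler_powR ?nnegrE ?divr_ge0 //; try lra.
  by rewrite ler_pdivrMr // mulrAC ler_pdivlMr // mul1r mulrC.
have r0 : 0 < l%:R / #|V|%:R :> R by rewrite divr_gt0.
have -> : l%:R / #|V|%:R * D =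
    (#|V|%:R / l%:R) `^ K * ((l%:R / #|V|%:R) `^ (1 + K) * D).
  have -> : (l%:R / #|V|%:R : R) `^ (1 + K) =
            (l%:R / #|V|%:R) `^ 1 * (l%:R / #|V|%:R) `^ K.
    by apply: powRD; rewrite (gt_eqF r0) implybT.
  rewrite (powRr1 (ltW r0)) mulrA [_ * (_ * _)]mulrCA -powRM ?divr_ge0 ?(ltW n0) ?(ltW l0) //.
  have -> : #|V|%:R / l%:R * (l%:R / #|V|%:R) = 1 :> R by field; rewrite !gt_eqF.
  by rewrite powR1 mulr1.
by rewrite ler_wpM2l ?powR_ge0.
Qed.

End Main.

Theorem theorem5p1 (R : realType) :
  (exists K : R, 0 < K /\
    forall (q : nat) (V bV : finType) (S : spin_system R q V bV) (eta b : R),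
    (2 <= q)%N -> feasible S -> totally_connected S ->
    spectrally_independent S eta -> marginally_bounded S b ->
    exists C : R, C <= K * (1 + eta / b) /\
      forall (l : nat) (f : config q V -> R),
      (1 <= l <= #|V| - 1)%N ->
      (forall s, s \in Omega S -> 0 <= f s) ->
      #|V|%:R / l%:R * average_card l (fun U => ent S (mu_given S U f))
        <= C * ent S f)
  /\
  (exists K : R, 0 < K /\
    forall (q : nat) (V bV : finType) (S : spin_system R q V bV) (eta b : R),
    (2 <= q)%N -> feasible S -> totally_connected S ->
    spectrally_independent S eta -> marginally_bounded S b ->
    forall theta : R, 0 < theta <= 1 ->
    exists C : R, C <= (1 / theta) `^ (K * (eta / b)) /\
      forall (l : nat) (f : config q V -> R),
      l%:Z = Num.ceil (theta * #|V|%:R) ->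
      (forall s, s \in Omega S -> 0 <= f s) ->
      l%:R / #|V|%:R * ent S f
        <= C * average_card l (fun L => mean_ent_on S L f)).
Proof.
split.
  exists 4; split=> // q V bV S eta b _ feas _ SI MB.
  exists (1 + 4 * (eta / b)); split; first by lra.
  by move=> l f lV f0; exact: ent_average_le.
exists 4096; split=> // q V bV S eta b _ feas TC SI MB theta th.
exists ((1 / theta) `^ (4096 * (eta / b))); split=> // l f lE f0.
exact: ent_le_average_mean.
Qed.
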